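(* (Static refutational completeness.) Consider the delayed-unification superposition calculus $\mathit{Inf}$ with redundancy criterion $(\mathit{Red}_I,\mathit{Red}_{Cl})$, both described in the context. Let $N$ be a set of clauses saturated up to redundancy by $\mathit{Inf}$, i.e. every inference of $\mathit{Inf}$ with premises in $N$ belongs to $\mathit{Red}_I(N)$. Then $N\models\bot$ if and only if $\bot\in N$.
   Context: **Logic and clauses.** We work in monomorphic first-order logic with equality. The signature is a finite set of typed function symbols, and the only predicate is $\approx$. A non-equality atom $A$ is encoded as $A\approx\top$. Literals are $s\approx t$ or $s\not\approx t$. Equations are symmetric, and $s\doteq t$ denotes either kind of literal. Clauses are finite multisets of literals, read disjunctively, and $\bot$ is the empty clause. Substitutions are idempotent. $\mathcal{G}(C)=\{C\theta\mid\theta\text{ grounding for }C\}$, and $\mathcal{G}(N)=\bigcup_{C\in N}\mathcal{G}(C)$. $\models$ is standard (Tarski) first-order entailment. **Ordering.** $\succ$ is a simplification ordering: well-founded, total on ground terms, compatible with contexts, and stable under substitution. It is extended to literals by treating $s\approx s'$ as $\{s,s'\}$ and $s\not\approx s'$ as $\{s,s,s',s'\}$ under the multiset extension, and to clauses by the multiset extension. **Selection and eligibility.** A selection function $\mathit{sel}$ maps a clause to a subset of its negative literals. A literal $l$ is $\sigma$-eligible in $C=C'\vee l$ if either $l\in\mathit{sel}(C)$, or nothing is selected in $C$ and $l\sigma$ is maximal in $C\sigma$. Strict $\sigma$-eligibility uses strict maximality. ''Eligible'' means $\sigma$ is empty. **The calculus $\mathit{Inf}$.** Let $\mathcal{CS}=t_1\not\approx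 s_1\vee\dots\vee t_n\not\approx s_n$, and let $s[u]$ denote a term $s$ with a subterm occurrence $u$. (Sup) From $D'\vee f(\bar t_n)\approx t'$ and $C'\vee s[f(\bar s_n)]\doteq s'$, derive $C'\vee D'\vee s[t']\doteq s'\vee\mathcal{CS}$. (VSup) From $D'\vee x\approx t'$ and $C'\vee s[f(\bar s_n)]\doteq s'$, derive $(C'\vee D'\vee s[t']\doteq s')\sigma$, where $\sigma=\{x\mapsto f(\bar s_n)\}$. For Sup, $\sigma$ is empty. Both rules require the following, with $t$ being $f(\bar t_n)$ or $x$: - $t\approx t'$ is strictly $\sigma$-eligible in $D$. - The second literal is strictly $\sigma$-eligible if positive and $\sigma$-eligible if negative, in $C$. - $t\sigma\not\preceq t'\sigma$ and $s[f(\bar s_n)]\sigma\not\preceq s'\sigma$. - $C\sigma\not\preceq D\sigma$. (EqFact) From $C'\vee f(\bar t_n)\approx v'\vee f(\bar s_n)\approx v$, derive $C'\vee v\not\approx v'\vee f(\bar s_n)\approx v\vee\mathcal{CS}$. Conditions: $f(\bar s_n)\approx v$ is eligible, $f(\bar s_n)\not\preceq v$, and $f(\bar t_n)\not\preceq v'$. (VEqFact) From $C'\vee u'\approx v'\vee u\approx v$, where $u$ or $u'$ is a variable and $\sigma=\mathrm{mgu}(u,u')$, derive $(C'\vee v\not\approx v'\vee u\approx v)\sigma$. Conditions: $u\approx v$ is $\sigma$-eligible, $u\sigma\not\preceq v\sigma$, and $u'\sigma\not\preceq v'\sigma$. (Decompose) From $C'\vee f(\bar s_n)\not\approx f(\bar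 t_n)$, where $f(\bar s_n)\neq f(\bar t_n)$, derive $C'\vee\mathcal{CS}$. (Bind) From $C'\vee x\not\approx t$, where $x\notin t$, derive $C'\{x\mapsto t\}$. (ReflDel) From $C'\vee s\not\approx s$, derive $C'$. For Decompose, Bind and ReflDel, the last literal must be $\sigma$-eligible ($\sigma$ is empty except for Bind). **Ground systems.** For a ground selection function $\mathit{gsel}$, $\mathit{GInf}^{\mathit{gsel}}$ is ground superposition with eligibility with respect to $\mathit{gsel}$. (GSup) From $D'\vee t\approx t'$ and $C'\vee s[t]\doteq s'$, derive $C'\vee D'\vee s[t']\doteq s'$. Conditions: $t\approx t'$ is strictly eligible; the second literal is strictly eligible if positive and eligible if negative; $t\succ t'$; $s[t]\succ s'$; $C\succ D$. The maximal premise is $C$. (GEqFact) From $C'\vee u\approx v'\vee u\approx v$, derive $C'\vee v\not\approx v'\vee u\approx v$. Conditions: $u\approx v$ is eligible, $u\succ v$, and $u\succ v'$. (GEqRes) From $C'\vee s\not\approx s$, derive $C'$. Condition: the literal is eligible. **Ground selection functions.** $\mathcal{G}(\mathit{sel})$ is the set of ground selection functions $\mathit{gsel}$ such that for every ground clause $C$ there is $D$ with $C\in\mathcal{G}(D)$ and $\mathit{gsel}$ selects in $C$ the literals corresponding to those selected by $\mathit{sel}$ in $D$. **Grounding of inferences.** For $\iota\in\mathit{Inf}$ of the form $C_1,\dots,C_n\vdash E\vee\mathcal{CS}$ ($\mathcal{CS}$ empty for rules without constraints), $\mathcal{G}^{\mathit{gsel}}(\iota)$ is the set of $\iota_g\in\mathit{GInf}^{\mathit{gsel}}$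 of the form $C_1\theta,\dots,C_n\theta\vdash E\theta$ for grounding $\theta$. **Redundancy.** - $\mathit{GRed}_{Cl}(N)$, for ground $N$: the ground clauses $C$ entailed by finitely many clauses of $N$, each $\prec C$. - $\mathit{Red}_{Cl}(N)$: the clauses $C$ such that every $D\in\mathcal{G}(C)$ either lies in $\mathit{GRed}_{Cl}(\mathcal{G}(N))$, or there is $C'\in N$ with $D\in\mathcal{G}(C')$ and $C$ strictly subsumed by $C'$. - $\mathit{GRed}^{\mathit{gsel}}_I(N)$: the ground inferences with maximal premise $C$ and conclusion $E$ such that some premise is in $\mathit{GRed}_{Cl}(N)$, or $E$ is entailed by finitely many clauses of $N$, each $\prec C$. - $\mathit{Red}_I(N)$: the $\iota\in\mathit{Inf}$ such that for all $\mathit{gsel}\in\mathcal{G}(\mathit{sel})$ and all $\iota'\in\mathcal{G}^{\mathit{gsel}}(\iota)$, $\iota'\in\mathit{GRed}^{\mathit{gsel}}_I(\mathcal{G}(N))$.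
   Formalization: Every type is assumed to have a ground term; otherwise the claim fails, e.g. N = {f(x) ≉ f(x)} with x of a type without ground terms. Premises are taken renamed apart, and the simplification ordering includes the subterm property. *)

(* Defs.v *)
From Stdlib Require List.
From HB Require Import structures.
From mathcomp Require Import all_boot finmap multiset.

Set Implicit Arguments.
Unset Strict Implicit.
Unset Printing Implicit Defensive.

Local Open Scope mset_scope.

Definition mset_map {K L : choiceType} (f : K -> L) (A : {mset K}) : {mset L} :=
  seq_mset [seq f x | x <- A].

(* Dershowitz-Manna extension: B arises from A by replacing a nonempty X by
   elements each of which is below some element of X. *)
Definition mset_ext {K : choiceType} (gt : K -> K -> Prop) (A B : {mset K}) : Prop :=
  exists X Y : {mset K},
    [/\ X <> mset0, X `<=` A, B = (A `\` X) `+` Y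
      & forall y, y \in Y -> exists2 x, x \in X & gt x y].

Record signature := Signature {
  sort : choiceType;
  symb : finType;
  dom : symb -> seq sort;
  cod : symb -> sort
}.

Notation var S := (sort S * nat)%type.

Unset Elimination Schemes.
Inductive term (S : signature) := Var of var S | App of symb S & seq (term S).
Set Elimination Schemes.

Arguments Var {S}.
Arguments App {S}.

Definition term_ind (S : signature) (P : term S -> Prop)
    (HVar : forall x, P (Var x))
    (HApp : forall f ts, foldr (fun t => and (P t)) True ts -> P (App f ts)) :
  forall t, P t :=
  fix loop t : P t := match t with
  | Var x => HVar x
  | App f ts =>
    let fix iter us : foldr (fun t => and (P t)) True us :=
      if us is u :: us' then conj (loop u) (iter us') else Logic.I in
    HApp f ts (iter ts)
  end.

Section TermChoice.
Context {S : signature}.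

Fixpoint term_encode (t : term S) : GenTree.tree (var S + symb S) :=
  match t with
  | Var x => GenTree.Leaf (inl x)
  | App f ts => GenTree.Node 0 (GenTree.Leaf (inr f) :: map term_encode ts)
  end.

Fixpoint term_decode (g : GenTree.tree (var S + symb S)) : option (term S) :=
  match g with
  | GenTree.Leaf (inl x) => Some (Var x)
  | GenTree.Node _ (GenTree.Leaf (inr f) :: gs) =>
      Some (App f (pmap id (map term_decode gs)))
  | _ => None
  end.

Lemma term_encodeK : pcancel term_encode term_decode.
Proof.
elim=> //= f ts IH; congr (Some (App f _)).
by elim: ts IH => //= t ts IHts [-> /IHts ->].
Qed.

HB.instance Definition _ := Choice.copy (term S) (pcan_type term_encodeK).

End TermChoice.

(* A literal is a sign (true for an equation) together with the unordered pair
   of its sides, so that s = t and t = s are the same literal. *)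
Notation literal S := (bool * {mset (term S)})%type.
Notation clause S := {mset (literal S)}.

Section Syntax.
Context {S : signature}.
Implicit Types (t s : term S) (l : literal S) (C D : clause S).

Definition lit (b : bool) s t : literal S := (b, [mset s; t]).
Definition eqn := lit true.
Definition neq := lit false.
Definition bot : clause S := mset0.

Definition tsort t : sort S := match t with Var x => x.1 | App f _ => cod f end.

Fixpoint wf_term t : bool :=
  match t with
  | Var _ => true
  | App f ts => all wf_term ts && (map tsort ts == dom f)
  end.

Definition wf_literal l : Prop :=
  exists s t, [/\ l.2 = [mset s; t], wf_term s, wf_term t & tsort s = tsort t].
Definition wf_clause C : Prop := forall l, l \in C -> wf_literal l.

Fixpoint tvars t : seq (var S) :=
  match t with Var x => [:: x] | App _ ts => flatten (map tvars ts) end.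
Definition cvars C : seq (var S) :=
  flatten [seq flatten [seq tvars t | t <- l.2] | l <- C].

Definition ground_term t : bool := nilp (tvars t).
Definition ground_clause C : bool := nilp (cvars C).

Inductive context := Hole | CApp of symb S & seq (term S) & context & seq (term S).

Fixpoint fill (c : context) t : term S :=
  match c with
  | Hole => t
  | CApp f ls c' rs => App f (ls ++ fill c' t :: rs)
  end.

Definition subst := var S -> term S.
Implicit Types sigma theta : subst.

Fixpoint tsubst sigma t : term S :=
  match t with
  | Var x => sigma x
  | App f ts => App f (map (tsubst sigma) ts)
  end.
Definition lsubst sigma l : literal S := (l.1, mset_map (tsubst sigma) l.2).
Definition csubst sigma C : clause S := mset_map (lsubst sigma) C.

Definition sort_preserving sigma : Prop :=
  forall x, wf_term (sigma x) /\ tsort (sigma x) = x.1.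
Definition idempotent_subst sigma : Prop :=
  forall x, tsubst sigma (sigma x) = sigma x.
Definition is_subst sigma : Prop := sort_preserving sigma /\ idempotent_subst sigma.

Definition single (x : var S) t : subst := fun y => if y == x then t else Var y.

Definition is_mgu sigma s t : Prop :=
  [/\ is_subst sigma, tsubst sigma s = tsubst sigma t
    & forall tau, is_subst tau -> tsubst tau s = tsubst tau t ->
        exists2 delta, sort_preserving delta
          & forall x, tau x = tsubst delta (sigma x)].

Definition grounding theta C : Prop := is_subst theta /\ ground_clause (csubst theta C).

Definition instances C : clause S -> Prop :=
  fun Cg => exists2 theta, grounding theta C & Cg = csubst theta C.
Definition instances_set (N : clause S -> Prop) : clause S -> Prop :=
  fun Cg => exists2 C, N C & instances C Cg.

(* A many-sorted structure: the carriers are nonempty subsets of a common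
   universe, and interp is only constrained on well-sorted arguments. *)
Record structure := Structure {
  univ : Type;
  carrier : sort S -> univ -> Prop;
  interp : symb S -> seq univ -> univ;
  carrier_inhabited : forall a, exists u, carrier a u;
  interp_sorted : forall f us,
    List.Forall2 carrier (dom f) us -> carrier (cod f) (interp f us)
}.

Fixpoint eval (M : structure) (v : var S -> univ M) t : univ M :=
  match t with
  | Var x => v x
  | App f ts => interp f (map (eval v) ts)
  end.

Definition sat_literal (M : structure) (v : var S -> univ M) l : Prop :=
  exists s t, l.2 = [mset s; t] /\
    (if l.1 then eval v s = eval v t else eval v s <> eval v t).

Definition models (M : structure) C : Prop :=
  forall v : var S -> univ M, (forall x, carrier x.1 (v x)) ->
    exists2 l, l \in C & sat_literal v l.

Definition entails (N : clause S -> Prop) C : Prop :=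
  forall M : structure, (forall D, N D -> models M D) -> models M C.

(* Every carrier being nonempty, ground instances carry the meaning of a clause
   only if every sort has a ground term. *)
Definition sorts_inhabited : Prop :=
  forall a : sort S, exists t, [/\ wf_term t, ground_term t & tsort t = a].

End Syntax.

Arguments subst : clear implicits.
Arguments context : clear implicits.
Arguments structure : clear implicits.
Arguments sorts_inhabited : clear implicits.

Record simplification_order (S : signature) (gt : term S -> term S -> Prop) : Prop := {
  gt_irr : forall s, wf_term s -> ~ gt s s;
  gt_trans : forall s t u, wf_term s -> wf_term t -> wf_term u ->
    gt s t -> gt t u -> gt s u;
  gt_wf : well_founded (fun s t => [/\ wf_term s, wf_term t & gt t s]);
  gt_total : forall s t, wf_term s -> wf_term t -> ground_term s -> ground_term t ->
    [\/ s = t, gt s t | gt t s];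
  gt_context : forall c s t, wf_term s -> wf_term t -> tsort s = tsort t ->
    wf_term (fill c s) -> gt s t -> gt (fill c s) (fill c t);
  gt_stable : forall sigma s t, is_subst sigma -> wf_term s -> wf_term t ->
    gt s t -> gt (tsubst sigma s) (tsubst sigma t);
  gt_subterm : forall c s, c <> Hole -> wf_term (fill c s) -> gt (fill c s) s
}.

Section Calculus.
Context {S : signature} (gt : term S -> term S -> Prop).
Implicit Types (s t u v : term S) (l : literal S) (C D E : clause S).

Definition lit_mset l : {mset (term S)} := if l.1 then l.2 else l.2 `+` l.2.
Definition lit_gt l l' : Prop := mset_ext gt (lit_mset l) (lit_mset l').
Definition clause_gt C D : Prop := mset_ext lit_gt C D.

Definition term_le s t : Prop := s = t \/ gt t s.
Definition lit_le l l' : Prop := l = l' \/ lit_gt l' l.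
Definition clause_le C D : Prop := C = D \/ clause_gt D C.

Definition selection_function (sel : clause S -> clause S) : Prop :=
  forall C, wf_clause C -> sel C `<=` C /\ forall l, l \in sel C -> l.1 = false.

(* Eligibility of l in the clause l +` C', whose selected literals are L. *)
Definition eligible (L : clause S) (sigma : subst S) C' l : Prop :=
  l \in L \/
  L = mset0 /\ forall l', l' \in C' -> ~ lit_gt (lsubst sigma l') (lsubst sigma l).
Definition strictly_eligible (L : clause S) (sigma : subst S) C' l : Prop :=
  l \in L \/
  L = mset0 /\ forall l', l' \in C' -> ~ lit_le (lsubst sigma l) (lsubst sigma l').

Definition sup_eligible (L : clause S) (sigma : subst S) C' l : Prop :=
  if l.1 then strictly_eligible L sigma C' l else eligible L sigma C' l.

(* The last premise is the maximal one. *)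
Record ground_inference := GroundInference {
  gprems : seq (clause S);
  gconcl : clause S
}.

Section Ground.
Variable gsel : clause S -> clause S.

Inductive ground_rule : ground_inference -> Prop :=
| GSup D' t t' C' (c : context S) b s' :
    let lD := eqn t t' in let D := lD +` D' in
    let lC := lit b (fill c t) s' in let C := lC +` C' in
    strictly_eligible (gsel D) Var D' lD ->
    sup_eligible (gsel C) Var C' lC ->
    gt t t' -> gt (fill c t) s' -> clause_gt C D ->
    ground_rule (GroundInference [:: D; C]
      (C' `+` D' `+` [mset lit b (fill c t') s']))
| GEqFact C' u v v' :
    let l := eqn u v in let C := l +` (eqn u v' +` C') in
    eligible (gsel C) Var (eqn u v' +` C') l ->
    gt u v -> gt u v' ->
    ground_rule (GroundInference [:: C] (C' `+` [mset neq v v'; eqn u v]))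
| GEqRes C' s :
    let l := neq s s in let C := l +` C' in
    eligible (gsel C) Var C' l ->
    ground_rule (GroundInference [:: C] C').

Definition GInf (i : ground_inference) : Prop :=
  (forall C, C \in gprems i -> wf_clause C /\ ground_clause C) /\ ground_rule i.

End Ground.

(* A premise is used through a variant; the literals selected in the variant
   are the variants of those selected in the clause itself, which does not
   require sel to commute with renamings. *)
Record premise := Premise {
  parent : clause S;
  ren : var S -> var S
}.

Definition is_renaming (r : var S -> var S) : Prop :=
  injective r /\ forall x, (r x).1 = x.1.

Definition variant (p : premise) : clause S := csubst (Var \o ren p) (parent p).

(* The conclusion is main `+` constraints; the constraints are dropped when an
   inference is grounded. *)
Record inference := Inference {
  prems : seq premise;
  main : clause S;
  constraints : clause S
}.

Definition conclusion (i : inference) : clause S := main i `+` constraints i.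

Definition CS (ts ss : seq (term S)) : clause S :=
  seq_mset [seq neq p.1 p.2 | p <- zip ts ss].

Definition is_var t : bool := if t is Var _ then true else false.

Section Inf.
Variable sel : clause S -> clause S.

Definition selected (p : premise) : clause S := csubst (Var \o ren p) (sel (parent p)).

(* The premises of a superposition are renamed apart. *)
Definition sup_conditions (sigma : subst S) (p q : premise) D' t t' C' b s s' : Prop :=
  variant p = eqn t t' +` D' /\ variant q = lit b s s' +` C' /\
  (forall x, x \in cvars (variant p) -> x \notin cvars (variant q)) /\
  strictly_eligible (selected p) sigma D' (eqn t t') /\
  sup_eligible (selected q) sigma C' (lit b s s') /\
  ~ term_le (tsubst sigma t) (tsubst sigma t') /\
  ~ term_le (tsubst sigma s) (tsubst sigma s') /\
  ~ clause_le (csubst sigma (variant q)) (csubst sigma (variant p)).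

Inductive rule : inference -> Prop :=
| Sup p q D' f ts t' C' b (c : context S) ss s' :
    sup_conditions Var p q D' (App f ts) t' C' b (fill c (App f ss)) s' ->
    rule (Inference [:: p; q] (C' `+` D' `+` [mset lit b (fill c t') s']) (CS ts ss))
| VSup p q D' x t' C' b (c : context S) f ss s' :
    let sigma := single x (App f ss) in
    is_subst sigma ->
    sup_conditions sigma p q D' (Var x) t' C' b (fill c (App f ss)) s' ->
    rule (Inference [:: p; q]
      (csubst sigma (C' `+` D' `+` [mset lit b (fill c t') s'])) mset0)
| EqFact p C' f ts v' ss v :
    let l := eqn (App f ss) v in let l' := eqn (App f ts) v' in
    variant p = l +` (l' +` C') ->
    eligible (selected p) Var (l' +` C') l ->
    ~ term_le (App f ss) v -> ~ term_le (App f ts) v' ->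
    rule (Inference [:: p] (C' `+` [mset neq v v'; l]) (CS ts ss))
| VEqFact p C' u' v' u v sigma :
    let l := eqn u v in let l' := eqn u' v' in
    variant p = l +` (l' +` C') ->
    is_var u || is_var u' ->
    is_mgu sigma u u' ->
    eligible (selected p) sigma (l' +` C') l ->
    ~ term_le (tsubst sigma u) (tsubst sigma v) ->
    ~ term_le (tsubst sigma u') (tsubst sigma v') ->
    rule (Inference [:: p] (csubst sigma (C' `+` [mset neq v v'; l])) mset0)
| Decompose p C' f ss ts :
    let l := neq (App f ss) (App f ts) in
    variant p = l +` C' ->
    App f ss <> App f ts ->
    eligible (selected p) Var C' l ->
    rule (Inference [:: p] C' (CS ss ts))
| Bind p C' x t :
    let l := neq (Var x) t in
    variant p = l +` C' ->
    x \notin tvars t ->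
    eligible (selected p) (single x t) C' l ->
    rule (Inference [:: p] (csubst (single x t) C') mset0)
| ReflDel p C' s :
    let l := neq s s in
    variant p = l +` C' ->
    eligible (selected p) Var C' l ->
    rule (Inference [:: p] C' mset0).

Definition Inf (i : inference) : Prop :=
  (forall p, List.In p (prems i) -> is_renaming (ren p)) /\ rule i.

Definition ground_selection (gsel : clause S -> clause S) : Prop :=
  forall C, wf_clause C -> ground_clause C ->
    exists D theta, [/\ wf_clause D, grounding theta D, C = csubst theta D
      & gsel C = csubst theta (sel D)].

Definition ground_inferences (gsel : clause S -> clause S) (i : inference) :
    ground_inference -> Prop :=
  fun ig => GInf gsel ig /\
    exists theta, [/\ is_subst theta,
      gprems ig = [seq csubst theta (variant p) | p <- prems i]
      & gconcl ig = csubst theta (main i)].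

Definition entailed_below (N : clause S -> Prop) C E : Prop :=
  exists Ds : seq (clause S),
    (forall D, D \in Ds -> N D /\ clause_gt C D) /\ entails (fun D => D \in Ds) E.

Definition GRed_Cl (N : clause S -> Prop) C : Prop :=
  [/\ wf_clause C, ground_clause C & entailed_below N C C].

Definition GRed_I (gsel : clause S -> clause S) (N : clause S -> Prop) :
    ground_inference -> Prop :=
  fun ig => GInf gsel ig /\
    ((exists2 C, C \in gprems ig & GRed_Cl N C) \/
     entailed_below N (last bot (gprems ig)) (gconcl ig)).

Definition Red_I (N : clause S -> Prop) : inference -> Prop :=
  fun i => Inf i /\
    forall gsel, ground_selection gsel ->
    forall ig, ground_inferences gsel i ig -> GRed_I gsel (instances_set N) ig.

Definition saturated (N : clause S -> Prop) : Prop :=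
  forall i, Inf i -> (forall p, List.In p (prems i) -> N (parent p)) -> Red_I N i.

End Inf.
End Calculus.

(* Main.v *)
(* The set of ground instances of N is interpreted by a rewrite system built by
   recursion on ground terms: t -> t' is a rule if, with respect to the rules for
   smaller terms, t is irreducible and a minimal falsified ground instance has
   the strictly maximal literal t = t', its other literals remaining false once
   the rule is added.  Suppose that a minimal ground instance C is false in the
   limit, and that bot is not in N.  The clause C is an instance of its
   representative by an irreducible substitution, since otherwise normalising
   the substitution gives a smaller counterexample.  Then a GEqRes, GEqFact or
   GSup inference with maximal premise C has a false conclusion and no redundant
   premise.  It is the grounding of an inference of the calculus: the constraints
   t_i <> s_i which replace unification are dropped by grounding, and they are
   false in the instance, so it suffices that the heads of the unified terms
   agree.  Saturation makes the conclusion a consequence of instances smaller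
   than C, which are true, a contradiction. *)
From mathcomp Require Import all_boot finmap multiset zify.
From mathcomp.classical Require Import boolp.
Require Import Defs.

Set Implicit Arguments.
Unset Strict Implicit.
Unset Printing Implicit Defensive.

Local Open Scope mset_scope.

(** * Multisets and their orderings *)

(** The recursion runs over terms rather than clauses, so it is not built in that a producing clause
    lies below the counterexample that it rewrites. This is recovered as follows: an instance
    smaller than the producer is true with respect to the rules below [u], and of its literals only
    some [neq u w] can turn false once [u] becomes reducible; but such a literal exceeds the maximal
    literal [eqn u r] of the producer. Irredundancy is needed for both premises of a superposition
    and is tested in two different structures: the counterexample is minimal for the final model,
    the producer for the rules below its left-hand side. Saturation concerns every ground selection
    function, so one may be tailored to the proof: each instance has a fixed representative and
    grounding, and selection is copied along this very pair. Lifting then knows only the grounding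
    [theta]. Each substitution [sigma] of a lifted inference is such that [sigma] followed by
    [theta] is [theta]; by stability of the order, an ordering condition violated by [sigma] would
    already be violated on the ground level. *)

Section MsetMap.
Context {K L : choiceType}.
Implicit Types (A B : {mset K}) (f : K -> L).

Lemma mset_ind (P : {mset K} -> Prop) :
  P mset0 -> (forall a A, P A -> P (a +` A)) -> forall A, P A.
Proof.
move=> P0 PS A; rewrite -[A]seq_mset_id; elim: (A : seq K) => [|a s IH].
  by rewrite (_ : seq_mset [::] = mset0) //; apply/msetP => x; rewrite mset_seqE mset0E.
by rewrite mset_cons; apply: PS.
Qed.

Lemma mset_mapE f A y : mset_map f A y = count (fun x => f x == y) A.
Proof. by rewrite mset_seqE count_map; apply: eq_count => x /=. Qed.

Lemma mset_mapP f A y : reflect (exists2 x, x \in A & y = f x) (y \in mset_map f A).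
Proof. by rewrite (perm_mem (perm_eq_seq_mset _)); apply: mapP. Qed.

Lemma mset_map_f f A x : x \in A -> f x \in mset_map f A.
Proof. by move=> xA; apply/mset_mapP; exists x. Qed.

Lemma enum_msetD A B : perm_eq (A `+` B) (A ++ B).
Proof.
apply/allP => x _ /=.
by rewrite count_cat !count_mem_mset msetE2.
Qed.

Lemma mset_mapD f A B : mset_map f (A `+` B) = mset_map f A `+` mset_map f B.
Proof.
apply/msetP => y; rewrite msetE2 !mset_mapE -count_cat.
exact/permP/enum_msetD.
Qed.

Lemma mset_map0 f : mset_map f mset0 = mset0.
Proof. by apply/msetP => y; rewrite mset_mapE enum_mset0 mset0E. Qed.

Lemma mset_map1 f x : mset_map f [mset x] = [mset f x].
Proof.
apply/msetP => y; rewrite mset_mapE enum_msetn /= msetnE eq_sym addn0.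
by case: (y == f x).
Qed.

Lemma mset_map2 f x y : mset_map f [mset x; y] = [mset f x; f y].
Proof. by rewrite mset_mapD !mset_map1. Qed.

Lemma mset_map_eq0 f A : mset_map f A = mset0 -> A = mset0.
Proof.
move=> A0; apply/msetP => x; rewrite mset0E; apply/mset_eq0P/negP => xA.
by have := mset_map_f f xA; rewrite A0 in_mset0.
Qed.

Lemma eq_in_mset_map f g A : {in A, f =1 g} -> mset_map f A = mset_map g A.
Proof. by move=> fg; congr seq_mset; apply/eq_in_map. Qed.

Lemma mset_map_splitW f A y (B : {mset L}) x : mset_map f A = y +` B -> x \in A -> f x = y ->
  exists2 A', A = x +` A' & mset_map f A' = B.
Proof.
move=> fA xA fx; exists (A `\ x); first by rewrite msetB1K.
by move: fA; rewrite -{1}(msetB1K xA) mset_mapD mset_map1 fx => /(congr1 (msetB^~ [mset y]));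
  rewrite !msetD1K.
Qed.

Lemma mset_map_split f A y (B : {mset L}) : mset_map f A = y +` B ->
  exists x A', [/\ A = x +` A', f x = y & mset_map f A' = B].
Proof.
move=> fA; have: y \in mset_map f A by rewrite fA mset1D1.
case/mset_mapP => x xA fx.
by have [A' -> fA'] := mset_map_splitW fA xA (esym fx); exists x, A'.
Qed.

Lemma mset_addKl (C A B : {mset K}) : C `+` A = C `+` B -> A = B.
Proof. by move=> /(congr1 (msetB^~ C)); rewrite !msetDKB. Qed.

Lemma mset2_inj (a b c d : K) : [mset a; b] = [mset c; d] ->
  (a = c /\ b = d) \/ (a = d /\ b = c).
Proof.
move=> E; have: a \in [mset c; d] by rewrite -E mset21.
case/mset2P => ac; subst a; [left|right]; split=> //.
  by move: E => /mset_addKl/msetP/(_ b); rewrite !msetnE eqxx; case: eqP.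
by move: E; rewrite (msetDC [mset c]) => /mset_addKl/msetP/(_ b); rewrite !msetnE eqxx; case: eqP.
Qed.

Lemma mset_partition (P Q : K -> Prop) A : (forall a, a \in A -> P a \/ Q a) ->
  exists A1 A2, [/\ A = A1 `+` A2, forall a, a \in A1 -> P a & forall a, a \in A2 -> Q a].
Proof.
elim/mset_ind: A => [|a A IH] PQ.
  by exists mset0, mset0; split; rewrite ?mset0D // => b; rewrite in_mset0.
have [|A1 [A2 [-> PA QA]]] := IH; first by move=> b bA; apply: PQ; rewrite mset1Dr.
case: (PQ a); first by rewrite mset1D1.
  move=> Pa; exists (a +` A1), A2; split=> //; first by rewrite msetDA.
  by move=> b; rewrite in_mset1D => /orP[/eqP->|/PA].
move=> Qa; exists A1, (a +` A2); split=> //; first by rewrite msetDCA.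
by move=> b; rewrite in_mset1D => /orP[/eqP->|/QA].
Qed.

Lemma mset_neq0_ex A : A <> mset0 -> exists a, a \in A.
Proof.
elim/mset_ind: A => [//|a A _ _]; by exists a; rewrite mset1D1.
Qed.

End MsetMap.

Arguments mset_ind [K].

Lemma mset_map_id (K : choiceType) (A : {mset K}) : mset_map id A = A.
Proof. by rewrite /mset_map map_id seq_mset_id. Qed.

Lemma mset_map_comp (K L M : choiceType) (f : K -> L) (g : L -> M) (A : {mset K}) :
  mset_map g (mset_map f A) = mset_map (g \o f) A.
Proof.
elim/mset_ind: A => [|a A IH]; first by rewrite !mset_map0.
by rewrite !mset_mapD !mset_map1 IH.
Qed.

(** Naming the common part [Z] replaces the truncated difference by sums, which commute with
    [mset_map]. *)
Lemma mset_extP (K : choiceType) (gt : K -> K -> Prop) (A B : {mset K}) : mset_ext gt A B <->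
  exists Z X Y : {mset K}, [/\ X <> mset0, A = Z `+` X, B = Z `+` Y
    & forall y, y \in Y -> exists2 x, x \in X & gt x y].
Proof.
split=> [[X [Y [X0 XA -> XY]]]|[Z [X [Y [X0 -> -> XY]]]]].
  by exists (A `\` X), X, Y; split=> //; rewrite msetBDK.
exists X, Y; split=> //; last by rewrite msetDKBC.
by apply/msubsetP => x; rewrite msetE2 leq_addl.
Qed.

Section MsetExt.
Context {K : choiceType}.
Implicit Types (A B X Y Z : {mset K}) (gt : K -> K -> Prop).

Lemma mset_ext_dominated gt A B a : a \in A -> (forall b, b \in B -> gt a b) ->
  mset_ext gt A B.
Proof.
move=> aA aB; apply/mset_extP; exists mset0, A, B; rewrite !mset0D; split=> //.
  by move=> A0; rewrite A0 in_mset0 in aA.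
by move=> y /aB; exists a.
Qed.

Lemma mset_ext_sub gt gt' A B :
  (forall a b, a \in A -> b \in B -> gt a b -> gt' a b) ->
  mset_ext gt A B -> mset_ext gt' A B.
Proof.
move=> sub /mset_extP[Z [X [Y [X0 EA EB XY]]]]; apply/mset_extP; exists Z, X, Y.
split=> // y yY; have [x xX gxy] := XY _ yY; exists x => //.
by apply: sub; rewrite ?EA ?EB ?in_msetD ?xX ?yY ?orbT.
Qed.

Lemma mset_ext_map (L : choiceType) gt (gt' : L -> L -> Prop) (f : K -> L) A B :
  (forall a b, a \in A -> b \in B -> gt a b -> gt' (f a) (f b)) ->
  mset_ext gt A B -> mset_ext gt' (mset_map f A) (mset_map f B).
Proof.
move=> mono /mset_extP[Z [X [Y [X0 EA EB XY]]]]; apply/mset_extP.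
exists (mset_map f Z), (mset_map f X), (mset_map f Y).
rewrite EA EB !mset_mapD; split=> //; first by move/mset_map_eq0.
move=> _ /mset_mapP[y yY ->]; have [x xX gxy] := XY _ yY.
exists (f x); first exact: mset_map_f.
by apply: mono; rewrite ?EA ?EB ?in_msetD ?xX ?yY ?orbT.
Qed.

(** The elements on which [f] and [g] agree form the common part and the others decrease; [a] is set
    aside beforehand so that the decreasing part is nonempty. *)
Lemma mset_ext_map2 (L : choiceType) (gt' : L -> L -> Prop) (f g : K -> L) A a :
  (forall x, x \in A -> f x = g x \/ gt' (f x) (g x)) ->
  a \in A -> gt' (f a) (g a) -> mset_ext gt' (mset_map f A) (mset_map g A).
Proof.
move=> fg aA fga; rewrite -(msetB1K aA).
have {}fg x : x \in A `\ a -> f x = g x \/ gt' (f x) (g x).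
  by move=> xA; apply: fg; rewrite in_msetB1 in xA; case/andP: xA.
have [A1 [A2 [-> eqfg gtfg]]] := mset_partition fg.
apply/mset_extP; exists (mset_map f A1), (mset_map f (a +` A2)), (mset_map g (a +` A2)).
split.
- by move/mset_map_eq0 => /msetP/(_ a); rewrite mset1DE eqxx mset0E.
- by rewrite msetDCA mset_mapD.
- by rewrite msetDCA mset_mapD; congr (_ `+` _); apply: eq_in_mset_map => x /eqfg.
move=> _ /mset_mapP[x + ->]; rewrite in_mset1D => /orP[/eqP->|xA].
  by exists (f a) => //; rewrite mset_map_f ?mset1D1.
by exists (f x); [rewrite mset_map_f ?mset1Dr | apply: gtfg].
Qed.

(** Adding one element preserves accessibility, by an outer induction on the element [a] and an
    inner one on the accessibility of [A]. *)
Lemma mset_ext_wf (lt : K -> K -> Prop) :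
  well_founded lt -> well_founded (fun B A => mset_ext (fun x y => lt y x) A B).
Proof.
move=> wf; set lt' := fun B A => _.
suff addP a A : Acc lt' A -> Acc lt' (a +` A).
  move=> A; elim/mset_ind: A => [|a A IH]; last exact: addP.
  constructor=> B /mset_extP[Z [X [Y [X0 E _ _]]]]; case: X0.
  by apply/msetP => x; move/msetP/(_ x): E; rewrite msetE2 mset0E; lia.
elim/(well_founded_ind wf): a A => a IHa A; elim=> {}A AccA IHA.
constructor=> B /mset_extP[Z [X [Y [X0 EA -> XY]]]].
(* If [a] survives in [Z], only [A] has decreased and the inner induction applies. Otherwise [a] is
   replaced by elements below it ([Y1]), which the outer induction adds back one at a time. *)
have [aX|aX] := boolP (a \in X); last first.
  have aZ : a \in Z.
    have: a \in Z `+` X by rewrite -EA mset1D1.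
    by rewrite in_msetD (negPf aX) orbF.
  rewrite -(msetB1K aZ) -msetDA; apply: IHA.
  apply/mset_extP; exists (Z `\ a), X, Y; split=> //.
  by move: EA; rewrite -{1}(msetB1K aZ) -msetDA => /mset_addKl.
have [|Y1 [Y2 [-> Y1a Y2X]]] :=
    @mset_partition _ (lt^~ a) (fun y => exists2 x, x \in X `\ a & lt y x) Y.
  move=> y yY; have [x xX lt_yx] := XY _ yY.
  have [<-|xa] := eqVneq x a; first by left.
  by right; exists x => //; rewrite in_msetB1 (negPf xa).
have {}EA : A = Z `+` (X `\ a).
  by move: EA; rewrite -{1}(msetB1K aX) msetDCA => /mset_addKl.
have AccZ : Acc lt' (Z `+` Y2).
  have [X'0|X'0] := eqVneq (X `\ a) mset0.
    suff -> : Y2 = mset0 by rewrite msetD0; rewrite EA X'0 msetD0 in AccA IHA *; constructor.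
    apply: contrapT => /mset_neq0_ex[y /Y2X[x]]; by rewrite X'0 in_mset0.
  apply: AccA; apply/mset_extP; exists Z, (X `\ a), Y2; split=> //; exact/eqP.
rewrite (msetDC Y1) msetDA.
elim/mset_ind: Y1 Y1a {XY} => [|y Y1 IHY] Y1a; first by rewrite msetD0.
rewrite msetDCA; apply: IHa; first by apply: Y1a; rewrite mset1D1.
by apply: IHY => z zY; apply: Y1a; rewrite mset1Dr.
Qed.

Lemma mset_max gt A : (forall x y z, x \in A -> y \in A -> z \in A -> gt x y -> gt y z -> gt x z) ->
  (forall x y, x \in A -> y \in A -> [\/ x = y, gt x y | gt y x]) ->
  A <> mset0 -> exists2 m, m \in A & forall x, x \in A -> x = m \/ gt m x.
Proof.
elim/mset_ind: A => [//|a A IH] tr tot _.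
have [->|/eqP A0] := eqVneq A mset0.
  by exists a; rewrite ?mset1D1 // => x; rewrite in_mset1D in_mset0 orbF => /eqP ->; left.
have [||//|m mA mP] := IH.
- by move=> x y z xA yA zA; apply: tr; rewrite mset1Dr.
- by move=> x y xA yA; apply: tot; rewrite mset1Dr.
have aA := mset1D1 a A; have mA' := mset1Dr a mA.
case: (tot a m aA mA') => [Eam|gam|gma].
- exists m => // x; rewrite in_mset1D => /orP[/eqP->|/mP //]; by left.
- exists a => // x; rewrite in_mset1D => /orP[/eqP->|xA]; first by left.
  right; case: (mP _ xA) => [->//|]; apply: tr => //; exact: mset1Dr.
- by exists m => // x; rewrite in_mset1D => /orP[/eqP->|/mP //]; right.
Qed.

(** The largest element of the symmetric difference decides: the multiset that contains it more
    often is the larger one. *)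
Lemma mset_ext_total gt (P : K -> Prop) :
  (forall x y z, P x -> P y -> P z -> gt x y -> gt y z -> gt x z) ->
  (forall x y, P x -> P y -> [\/ x = y, gt x y | gt y x]) ->
  forall A B, (forall x, x \in A -> P x) -> (forall x, x \in B -> P x) ->
  [\/ A = B, mset_ext gt A B | mset_ext gt B A].
Proof.
move=> tr tot A B PA PB.
pose U := (A `\` B) `+` (B `\` A).
have PU x : x \in U -> P x.
  rewrite in_msetD !in_msetB => /orP[] lt_x; [apply: PA|apply: PB]; rewrite in_mset; lia.
have [U0|/eqP U0] := eqVneq U mset0.
  constructor 1; apply/msetP => x; move/msetP/(_ x): U0; rewrite !msetE2 mset0E; lia.
have [m mU mP] : exists2 m, m \in U & forall x, x \in U -> x = m \/ gt m x.
  apply: mset_max => // [x y z /PU ? /PU ? /PU ?|x y /PU ? /PU ?]; [exact: tr|exact: tot].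
have main A' B' : m \in A' `\` B' -> (forall x, x \in B' `\` A' -> x = m \/ gt m x) ->
    mset_ext gt A' B'.
  move=> mA mB; apply/mset_extP; exists (A' `&` B'), (A' `\` B'), (B' `\` A'); split.
  - by move=> E; rewrite E in_mset0 in mA.
  - by apply/msetP => x; rewrite !msetE2; lia.
  - by apply/msetP => x; rewrite !msetE2; lia.
  - move=> y yB; exists m => //; case: (mB _ yB) => // Eym.
    by subst y; move: mA yB; rewrite !in_msetB; lia.
move: mU; rewrite in_msetD => /orP[mA|mB]; [constructor 2|constructor 3];
  by apply: main => // x xB; apply: mP; rewrite in_msetD xB ?orbT.
Qed.

End MsetExt.

(* Totality and well-foundedness give asymmetry and transitivity, so these need
   no proof of their own for the multiset extensions. *)
Section WfTotal.
Context {T : Type} (P : T -> Prop) (gt : T -> T -> Prop).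
Hypothesis wf : well_founded (fun y x => [/\ P x, P y & gt x y]).
Hypothesis total : forall x y, P x -> P y -> [\/ x = y, gt x y | gt y x].

Lemma wf_asym x y : P x -> P y -> gt x y -> gt y x -> False.
Proof.
elim/(well_founded_ind wf): x y => x IH y Px Py gxy gyx.
exact: (IH y _ x).
Qed.

Lemma wf_irr x : P x -> ~ gt x x.
Proof. by move=> Px gxx; apply: (wf_asym Px Px gxx). Qed.

Lemma wf_total_trans x y z : P x -> P y -> P z -> gt x y -> gt y z -> gt x z.
Proof.
elim/(well_founded_ind wf): x y z => x IH y z Px Py Pz gxy gyz.
case: (total Px Pz) => // [E|gzx]; first by subst z; case: (wf_asym Px Py gxy).
(* With [z] above [x], the chain [y], [z], [x] starts at the smaller element [y], so the induction
   hypothesis puts [y] above [x]. *)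
by case: (wf_asym Px Py gxy); apply: (IH y _ z x).
Qed.

End WfTotal.

(** * Terms, substitutions and clauses *)

Section Terms.
Context {S : signature}.
Implicit Types (s t u : term S) (l : literal S) (C D : clause S) (c : context S).
Implicit Types (sigma theta : subst S).

Lemma term_mem_ind (P : term S -> Prop) :
  (forall x, P (Var x)) ->
  (forall f ts, (forall t, t \in ts -> P t) -> P (App f ts)) -> forall t, P t.
Proof.
move=> PV PA; elim=> // f ts IH; apply: PA => t.
elim: ts IH => //= u ts IHts [Pu Pts]; rewrite inE => /orP[/eqP->//|]; exact: IHts.
Qed.

Lemma tsubst_Var t : tsubst Var t = t.
Proof.
elim/term_mem_ind: t => //= f ts IH; congr App.
by rewrite -[RHS]map_id; apply/eq_in_map.
Qed.

Lemma tsubst_comp sigma theta t :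
  tsubst theta (tsubst sigma t) = tsubst (fun x => tsubst theta (sigma x)) t.
Proof.
elim/term_mem_ind: t => //= f ts IH; congr App.
by rewrite -map_comp; apply/eq_in_map.
Qed.

Lemma eq_in_tsubst sigma theta t : {in tvars t, sigma =1 theta} ->
  tsubst sigma t = tsubst theta t.
Proof.
elim/term_mem_ind: t => /= [x|f ts IH] eq_st; first by apply: eq_st; rewrite inE.
congr App; apply/eq_in_map => t tts; apply: IH => // x xt; apply: eq_st.
by apply/flattenP; exists (tvars t) => //; apply: map_f.
Qed.

Lemma tsubst_inj_in sigma theta t : tsubst sigma t = tsubst theta t ->
  {in tvars t, sigma =1 theta}.
Proof.
elim/term_mem_ind: t => /= [x|f ts IH].
  by move=> E y; rewrite inE => /eqP ->.
case=> /eq_in_map E x /flattenP[_ /mapP[t tts ->]]; apply: IH => //; exact: E.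
Qed.

Lemma tsort_tsubst sigma t : sort_preserving sigma -> tsort (tsubst sigma t) = tsort t.
Proof. by move=> sp; case: t => //= x; case: (sp x). Qed.

Lemma wf_tsubst sigma t : sort_preserving sigma -> wf_term t -> wf_term (tsubst sigma t).
Proof.
move=> sp; elim/term_mem_ind: t => /= [x _|f ts IH /andP[/allP wts /eqP <-]].
  by case: (sp x).
rewrite all_map -map_comp; apply/andP; split.
  by apply/allP => t tts; apply: IH => //; apply: wts.
by apply/eqP/eq_map => t; apply: tsort_tsubst.
Qed.

Lemma lsubst_lit sigma b s t :
  lsubst sigma (lit b s t) = lit b (tsubst sigma s) (tsubst sigma t).
Proof. by rewrite /lsubst /lit /= mset_map2. Qed.

Lemma litC b s t : lit b s t = lit b t s.
Proof. by rewrite /lit msetDC. Qed.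

Lemma lit_inj b b' s t s' t' : lit b s t = lit b' s' t' ->
  b = b' /\ ((s = s' /\ t = t') \/ (s = t' /\ t = s')).
Proof. by case=> -> /mset2_inj. Qed.

Lemma lsubst_Var l : lsubst Var l = l.
Proof.
case: l => b A; rewrite /lsubst /=; congr pair.
by rewrite -[RHS]mset_map_id; apply: eq_in_mset_map => t _; apply: tsubst_Var.
Qed.

Lemma csubst_Var C : csubst Var C = C.
Proof.
by rewrite -[RHS]mset_map_id; apply: eq_in_mset_map => t _; apply: lsubst_Var.
Qed.

Lemma eq_tsubst sigma theta : sigma =1 theta -> tsubst sigma =1 tsubst theta.
Proof. by move=> E t; apply: eq_in_tsubst => x _. Qed.

Lemma lsubst_comp sigma theta rho l :
  (forall x, tsubst theta (sigma x) = rho x) -> lsubst theta (lsubst sigma l) = lsubst rho l.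
Proof.
move=> E; rewrite /lsubst /= mset_map_comp; congr pair.
by apply: eq_in_mset_map => t _ /=; rewrite tsubst_comp; apply: eq_tsubst.
Qed.

Lemma csubst_comp sigma theta rho C :
  (forall x, tsubst theta (sigma x) = rho x) -> csubst theta (csubst sigma C) = csubst rho C.
Proof.
move=> E; rewrite /csubst mset_map_comp.
by apply: eq_in_mset_map => l _ /=; apply: lsubst_comp.
Qed.

Lemma csubstD sigma C D : csubst sigma (C `+` D) = csubst sigma C `+` csubst sigma D.
Proof. exact: mset_mapD. Qed.

Lemma csubst1 sigma l : csubst sigma [mset l] = [mset lsubst sigma l].
Proof. exact: mset_map1. Qed.

Lemma cvarsP C x :
  reflect (exists l t, [/\ l \in C, t \in l.2 & x \in tvars t]) (x \in cvars C).
Proof.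
apply: (iffP flattenP) => [[_ /mapP[l lC ->] /flattenP[_ /mapP[t tl ->] xt]]|].
  by exists l, t.
case=> l [t [lC tl xt]].
exists (flatten [seq tvars t | t <- (l.2 : seq _)]); first by apply/mapP; exists l.
by apply/flattenP; exists (tvars t) => //; apply: map_f.
Qed.

Lemma eq_in_csubst sigma theta C : {in cvars C, sigma =1 theta} ->
  csubst sigma C = csubst theta C.
Proof.
move=> E; apply: eq_in_mset_map => l lC; rewrite /lsubst; congr pair.
apply: eq_in_mset_map => t tl; apply: eq_in_tsubst => x xt; apply: E.
by apply/cvarsP; exists l, t.
Qed.

Definition gwf t := wf_term t && ground_term t.

Lemma ground_App (f : symb S) ts : ground_term (App f ts) = all ground_term ts.
Proof.
rewrite /ground_term /=; elim: ts => //= t ts IH.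
by rewrite -IH /nilp size_cat addn_eq0.
Qed.

Lemma gwf_App f ts : gwf (App f ts) = all gwf ts && (map tsort ts == dom f).
Proof. by rewrite /gwf /= ground_App all_predI -!andbA; congr andb; rewrite andbC. Qed.

Lemma gwf_wf t : gwf t -> wf_term t. Proof. by case/andP. Qed.

Lemma ground_termP t : reflect (forall x, x \notin tvars t) (ground_term t).
Proof.
rewrite /ground_term /nilp; case: (tvars t) => [|x xs] /=; first by left.
by right => /(_ x); rewrite inE eqxx.
Qed.

Definition ground_subst theta := forall x, gwf (theta x) /\ tsort (theta x) = x.1.

Lemma tsubst_ground sigma t : ground_term t -> tsubst sigma t = t.
Proof.
move=> /ground_termP gt; rewrite -[RHS]tsubst_Var; apply: eq_in_tsubst => x.
by rewrite (negPf (gt x)).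
Qed.

Lemma ground_subst_sorted theta : ground_subst theta -> sort_preserving theta.
Proof. by move=> gth x; have [/gwf_wf] := gth x. Qed.

Lemma ground_is_subst theta : ground_subst theta -> is_subst theta.
Proof.
move=> gth; split; first exact: ground_subst_sorted.
by move=> x; apply: tsubst_ground; have [/andP[]] := gth x.
Qed.

Lemma gwf_tsubst theta t : ground_subst theta -> wf_term t -> gwf (tsubst theta t).
Proof.
move=> gth wt; rewrite /gwf wf_tsubst //=; last exact: ground_subst_sorted.
elim/term_mem_ind: t wt => [x _|f ts IH /= /andP[/allP wts _]].
  by case: (gth x) => /andP[].
rewrite -/(tsubst theta (App f ts)) /= ground_App all_map; apply/allP => t tts /=.
by apply: IH => //; apply: wts.
Qed.

Lemma Var_is_subst : is_subst (@Var S).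
Proof. by split=> x. Qed.

Definition gwf_literal l :=
  exists b s t, [/\ l = lit b s t, gwf s, gwf t & tsort s = tsort t].
Definition gwf_clause C := forall l, l \in C -> gwf_literal l.

Lemma wf_literalP l : wf_literal l ->
  exists b s t, [/\ l = lit b s t, wf_term s, wf_term t & tsort s = tsort t].
Proof. by case: l => b A [s [t [/= -> ws wt st]]]; exists b, s, t. Qed.

Lemma wf_literal_mem l t : wf_literal l -> t \in l.2 -> wf_term t.
Proof. by case=> u [v [-> wu wv _]] /mset2P[]->. Qed.

Lemma wf_lit b s t : wf_literal (lit b s t) -> [/\ wf_term s, wf_term t & tsort s = tsort t].
Proof. by case=> u [v [/mset2_inj[[-> ->]|[-> ->]]]]. Qed.

Lemma gwf_lit b s t : gwf_literal (lit b s t) -> [/\ gwf s, gwf t & tsort s = tsort t].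
Proof. by case=> b' [u [v [/lit_inj[_ [[-> ->]|[-> ->]]]]]]. Qed.

Lemma gwf_literal_wf l : gwf_literal l -> wf_literal l.
Proof.
by case=> b [s [t [-> /gwf_wf ws /gwf_wf wt st]]]; exists s, t.
Qed.

Lemma gwf_literal_mem l t : gwf_literal l -> t \in l.2 -> gwf t.
Proof. by case=> b [u [v [-> gu gv _]]] /mset2P[]->. Qed.

Lemma gwf_clauseP C : gwf_clause C <-> wf_clause C /\ ground_clause C.
Proof.
split=> [gC|[wC gC] l lC].
  split; first by move=> l /gC/gwf_literal_wf.
  rewrite /ground_clause /nilp; case E : (cvars C) => [//|x xs].
  have /cvarsP[l [t [lC tl]]] : x \in cvars C by rewrite E inE eqxx.
  by have /andP[_ /ground_termP/(_ x)/negPf->] := gwf_literal_mem (gC _ lC) tl.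
have [b [s [t [E ws wt st]]]] := wf_literalP (wC _ lC).
have gl u : u \in l.2 -> ground_term u.
  move=> ul; apply/ground_termP => x; apply/negP => xu.
  have: x \in cvars C by apply/cvarsP; exists l, u.
  by move: gC; rewrite /ground_clause => /nilP ->.
by exists b, s, t; rewrite /gwf ws wt !gl // E ?mset21 ?mset22.
Qed.

Lemma wf_csubst sigma C : sort_preserving sigma -> wf_clause C -> wf_clause (csubst sigma C).
Proof.
move=> sp wC _ /mset_mapP[l /wC/wf_literalP[b [s [t [-> ws wt st]]]] ->].
by rewrite lsubst_lit; exists (tsubst sigma s), (tsubst sigma t);
  split; rewrite ?wf_tsubst // !tsort_tsubst.
Qed.

Lemma gwf_csubst theta C : ground_subst theta -> wf_clause C -> gwf_clause (csubst theta C).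
Proof.
move=> gth wC _ /mset_mapP[l /wC/wf_literalP[b [s [t [-> ws wt st]]]] ->].
rewrite lsubst_lit; exists b, (tsubst theta s), (tsubst theta t).
have sp := ground_subst_sorted gth.
by split; rewrite ?gwf_tsubst // !tsort_tsubst.
Qed.

Lemma lsubst_lit_inv theta l b s t : wf_literal l -> lsubst theta l = lit b s t ->
  exists s1 t1, [/\ l = lit b s1 t1, tsubst theta s1 = s & tsubst theta t1 = t].
Proof.
move=> /wf_literalP[b' [s1 [t1 [-> _ _ _]]]]; rewrite lsubst_lit => /lit_inj[-> [[<- <-]|[<- <-]]].
  by exists s1, t1.
by exists t1, s1; rewrite litC.
Qed.

Fixpoint ctxsubst sigma c : context S :=
  match c with
  | Hole => Hole
  | CApp f ls c' rs =>
      CApp f (map (tsubst sigma) ls) (ctxsubst sigma c') (map (tsubst sigma) rs)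
  end.

Lemma tsubst_fill sigma c t :
  tsubst sigma (fill c t) = fill (ctxsubst sigma c) (tsubst sigma t).
Proof. by elim: c => //= f ls c IH rs; rewrite map_cat /= IH. Qed.

Lemma wf_fill c t : wf_term (fill c t) -> wf_term t.
Proof.
elim: c => //= f ls c IH rs /andP[]; rewrite all_cat /= => /and3P[_ wf _] _; exact: IH.
Qed.

Lemma tsort_fill c t t' : tsort t = tsort t' -> tsort (fill c t) = tsort (fill c t').
Proof. by case: c. Qed.

Lemma gwf_fill_sub c t t' : tsort t = tsort t' -> gwf t' -> gwf (fill c t) -> gwf (fill c t').
Proof.
move=> st gt'; elim: c => //= f ls c IH rs; rewrite !gwf_App !all_cat !map_cat /=.
by rewrite (tsort_fill c st) => /andP[/and3P[-> /IH-> ->] ->].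
Qed.

Lemma mem_tvars_fill x t : x \in tvars t -> exists c, t = fill c (Var x).
Proof.
elim/term_mem_ind: t => /= [y|f ts IH].
  by rewrite inE => /eqP ->; exists Hole.
case/flattenP => _ /mapP[t tts ->] /(IH _ tts)[c E].
by case/splitPr: tts => ls rs; exists (CApp f ls c rs); rewrite /= E.
Qed.

Lemma cat_cons_inj (T : Type) (l1 l2 : seq T) a b r1 r2 :
  size l1 = size l2 -> l1 ++ a :: r1 = l2 ++ b :: r2 -> [/\ l1 = l2, a = b & r1 = r2].
Proof.
elim: l1 l2 => [|x l1 IH] [|y l2] //=; first by move=> _ [-> ->].
by move=> [sz] [-> /(IH _ sz)[-> -> ->]].
Qed.

(** Descend along [c] until it ends or [s] runs out at a variable. The second alternative, a
    position at or inside the image of a variable, is the one that lifting of superposition has to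
    exclude. *)
Lemma tsubst_eq_fill theta s c t : tsubst theta s = fill c t ->
  (exists c1 s1, [/\ s = fill c1 s1, ~~ is_var s1, tsubst theta s1 = t & ctxsubst theta c1 = c])
  \/ (exists x c1, x \in tvars s /\ theta x = fill c1 t).
Proof.
elim: c s => [|f ls c IH rs] [x|g ss] //=.
- by move=> E; right; exists x, Hole; rewrite inE.
- by move=> E; left; exists Hole, (App g ss).
- by move=> E; right; exists x, (CApp f ls c rs); rewrite inE.
case=> -> E.
have szls : size ls < size ss by rewrite -(size_map (tsubst theta) ss) E size_cat /=; lia.
pose d := fill c t.
have Ess : ss = take (size ls) ss ++ nth d ss (size ls) :: drop (size ls).+1 ss.
  by rewrite -drop_nth // cat_take_drop.
have szt : size (map (tsubst theta) (take (size ls) ss)) = size ls.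
  by rewrite size_map size_takel // ltnW.
move: E; rewrite {1}Ess map_cat /= => /(cat_cons_inj szt)[El Ei Er].
case: (IH _ Ei) => [[c1 [s1 [Es nv st cc]]]|[x [c1 [xs xc]]]].
  left; exists (CApp f (take (size ls) ss) c1 (drop (size ls).+1 ss)), s1.
  by split=> //=; rewrite -?Es -?Ess // El Er cc.
right; exists x, c1; split=> //; apply/flattenP.
by exists (tvars (nth d ss (size ls))) => //; rewrite map_f // mem_nth.
Qed.

Lemma is_subst_single x t : wf_term t -> tsort t = x.1 -> x \notin tvars t \/ t = Var x ->
  is_subst (single x t).
Proof.
move=> wt st xt; split=> y; rewrite /single; first by case: eqP => [->|].
case: (eqVneq y x) => [_|yx] /=.
  case: xt => [xt|->] /=; last by rewrite eqxx.
  rewrite -[RHS]tsubst_Var; apply: eq_in_tsubst => z zt /=.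
  by case: eqP => // zx; rewrite -zx zt in xt.
by rewrite (negPf yx).
Qed.

Lemma tsubst_single theta x t : theta x = tsubst theta t ->
  forall y, tsubst theta (single x t y) = theta y.
Proof. by move=> E y; rewrite /single; case: eqP => [->|]. Qed.

End Terms.

Arguments term_mem_ind [S].

(** * Orders on ground literals and clauses *)

Lemma wf_preimage (T U : Type) (R : U -> U -> Prop) (R' : T -> T -> Prop) (h : T -> U) :
  well_founded R -> (forall x y, R' x y -> R (h x) (h y)) -> well_founded R'.
Proof.
move=> wfR sub x; move E : (h x) => y.
elim/(well_founded_ind wfR): y x E => y IH x E; constructor => z /sub.
by rewrite E => Rzy; apply: IH Rzy _ erefl.
Qed.

Section Orders.
Context {S : signature} {gt : term S -> term S -> Prop} (gtP : simplification_order gt).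
Implicit Types (s t u : term S) (l : literal S) (C D : clause S) (c : context S).
Implicit Types (sigma theta : subst S).

Lemma gwf_wellfounded : well_founded (fun t s => [/\ gwf s, gwf t & gt s t]).
Proof.
apply: (wf_preimage (h := id) (gt_wf gtP)) => t s [/gwf_wf ws /gwf_wf wt gst].
by split.
Qed.

Lemma gwf_total s t : gwf s -> gwf t -> [\/ s = t, gt s t | gt t s].
Proof. by move=> /andP[ws gs] /andP[wt ggt]; apply: (gt_total gtP). Qed.

Lemma gwf_gt_trans s t u : gwf s -> gwf t -> gwf u -> gt s t -> gt t u -> gt s u.
Proof. by move=> /gwf_wf ? /gwf_wf ? /gwf_wf ?; apply: (gt_trans gtP). Qed.

Lemma gwf_gt_irr s : gwf s -> ~ gt s s.
Proof. by move=> /gwf_wf; apply: (gt_irr gtP). Qed.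

Lemma gwf_gt_asym s t : gwf s -> gwf t -> gt s t -> ~ gt t s.
Proof. by move=> gs ggt gst gts; apply: (gwf_gt_irr gs); apply: gwf_gt_trans gst gts. Qed.

Lemma gwf_le_trans s t u : gwf s -> gwf t -> gwf u ->
  term_le gt s t -> term_le gt t u -> term_le gt s u.
Proof.
move=> gs ggt gu [->//|gts] [<-|gut]; first by right.
by right; apply: gwf_gt_trans gut gts.
Qed.

Lemma gwf_le_lt_trans s t u : gwf s -> gwf t -> gwf u ->
  term_le gt s t -> gt u t -> gt u s.
Proof. by move=> gs ggt gu [->//|gts] gut; apply: gwf_gt_trans gut gts. Qed.

Lemma gwf_lt_le_trans s t u : gwf s -> gwf t -> gwf u ->
  gt t s -> term_le gt t u -> gt u s.
Proof. by move=> gs ggt gu gts [<-//|gut]; apply: gwf_gt_trans gut gts. Qed.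

Lemma gt_arg f ts t : wf_term (App f ts) -> t \in ts -> gt (App f ts) t.
Proof.
move=> wts tts; case/splitPr: tts wts => ls rs wts.
exact: (gt_subterm gtP (c := CApp f ls Hole rs)).
Qed.

Lemma App_map_le f ts (g h : term S -> term S) :
  (forall t, t \in ts -> [/\ gwf (g t), gwf (h t), tsort (g t) = tsort (h t)
                           & term_le gt (g t) (h t)]) ->
  gwf (App f (map h ts)) -> gwf (App f (map g ts)) /\
  term_le gt (App f (map g ts)) (App f (map h ts)).
Proof.
(* Compatibility with contexts changes one argument at a time; [ls] collects the arguments already
   replaced by their [g]-values. *)
rewrite -[map g ts]cat0s -[map h ts]cat0s; move: [::] => ls.
elim: ts ls => [|t ts IH] ls gh gA; first by split=> //; left.
have [ggt ght sgh le_gh] := gh t (mem_head _ _).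
have gA' : gwf (App f (ls ++ g t :: map h ts)).
  exact: (gwf_fill_sub (c := CApp f ls Hole (map h ts)) (esym sgh)).
have [||gB le_B] := IH (rcons ls (g t)).
- by move=> u uts; apply: gh; rewrite inE uts orbT.
- by rewrite cat_rcons.
rewrite !cat_rcons in gB le_B; split=> //.
apply: gwf_le_trans le_B _ => //.
case: le_gh => [->|lt_gh]; [by left|right].
apply: (gt_context gtP (c := CApp f ls Hole (map h ts))) => //; exact: gwf_wf.
Qed.

Lemma tsubst_le theta theta' t : ground_subst theta -> ground_subst theta' ->
  (forall x, term_le gt (theta' x) (theta x)) -> wf_term t ->
  term_le gt (tsubst theta' t) (tsubst theta t).
Proof.
move=> gth gth' le_th; elim/term_mem_ind: t => [x _|f ts IH wt] /=; first exact: le_th.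
apply: (proj2 (App_map_le _ _)) => [t tts|]; last exact: (gwf_tsubst gth wt).
have /= /andP[/allP wts _] := wt; have wtt := wts _ tts.
by rewrite !gwf_tsubst // !tsort_tsubst //; [split=> //; apply: IH|
  exact: ground_subst_sorted..].
Qed.

(** If [x] occurred properly in [t], then [theta x] would be a proper subterm of itself, against the
    subterm property and irreflexivity of [gt]. *)
Lemma occurs_check theta x t : ground_subst theta -> wf_term t ->
  theta x = tsubst theta t -> x \in tvars t -> t = Var x.
Proof.
move=> gth wt E /mem_tvars_fill[c Et]; case: c Et => // f ls c rs Et.
have gxt := gwf_tsubst gth wt; exfalso; apply: (gwf_gt_irr gxt).
rewrite -{2}E {1}Et tsubst_fill; apply: (gt_subterm gtP) => //.
by rewrite -(tsubst_fill _ (CApp _ _ _ _)) -Et; apply: gwf_wf.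
Qed.

Lemma mem_lit_mset l t : (t \in lit_mset l) = (t \in l.2).
Proof. by rewrite /lit_mset; case: l.1; rewrite ?in_msetD ?orbb. Qed.

Lemma lit_mset_lsubst sigma l :
  lit_mset (lsubst sigma l) = mset_map (tsubst sigma) (lit_mset l).
Proof. by rewrite /lit_mset /=; case: l.1; rewrite ?mset_mapD. Qed.

Lemma size_mset2 (K : choiceType) (a b : K) : size [mset a; b] = 2.
Proof. by rewrite (perm_size (enum_msetD _ _)) !enum_msetn. Qed.

(** An equation is encoded by two terms and a disequation by four, so the size recovers the sign.
    Totality of the literal order up to equality depends on it. *)
Lemma lit_mset_inj l l' : gwf_literal l -> gwf_literal l' ->
  lit_mset l = lit_mset l' -> l = l'.
Proof.
move=> [b [s [t [-> _ _ _]]]] [b' [s' [t' [-> _ _ _]]]].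
rewrite /lit_mset /lit /=; case: b; case: b' => /= E; first by rewrite E.
1,2: by have := congr1 (fun A : {mset _} => size A) E;
  rewrite !(perm_size (enum_msetD _ _)) !size_cat !size_mset2 !enum_msetn.
congr pair; apply/msetP => x; move/msetP/(_ x): E.
by rewrite msetE2 [RHS]msetE2; lia.
Qed.

Lemma lit_gt_wf : well_founded (fun l' l => [/\ gwf_literal l, gwf_literal l' & lit_gt gt l l']).
Proof.
apply: (wf_preimage (h := @lit_mset S) (mset_ext_wf gwf_wellfounded)).
move=> l' l [gl gl']; apply: mset_ext_sub => a b; rewrite !mem_lit_mset.
by move=> /(gwf_literal_mem gl) ga /(gwf_literal_mem gl') gb.
Qed.

Lemma lit_gt_total l l' : gwf_literal l -> gwf_literal l' ->
  [\/ l = l', lit_gt gt l l' | lit_gt gt l' l].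
Proof.
move=> gl gl'.
have: [\/ lit_mset l = lit_mset l', lit_gt gt l l' | lit_gt gt l' l].
  apply: (mset_ext_total gwf_gt_trans gwf_total) => x; rewrite mem_lit_mset;
    exact: gwf_literal_mem.
by case=> [/lit_mset_inj E||]; [constructor 1; apply: E|constructor 2|constructor 3].
Qed.

Definition lit_gt_trans := wf_total_trans lit_gt_wf lit_gt_total.

Lemma clause_gt_wf : well_founded (fun D C => [/\ gwf_clause C, gwf_clause D & clause_gt gt C D]).
Proof.
apply: (wf_preimage (h := id) (mset_ext_wf lit_gt_wf)).
by move=> D C [gC gD]; apply: mset_ext_sub => a b /gC ga /gD gb.
Qed.

Lemma clause_gt_total C D : gwf_clause C -> gwf_clause D ->
  [\/ C = D, clause_gt gt C D | clause_gt gt D C].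
Proof. move=> gC gD; exact: (mset_ext_total lit_gt_trans lit_gt_total). Qed.

Definition clause_gt_asym := wf_asym clause_gt_wf.

Lemma lit_gt_stable sigma l l' : is_subst sigma -> wf_literal l -> wf_literal l' ->
  lit_gt gt l l' -> lit_gt gt (lsubst sigma l) (lsubst sigma l').
Proof.
move=> ss wl wl'; rewrite /lit_gt !lit_mset_lsubst; apply: mset_ext_map => a b.
rewrite !mem_lit_mset => al bl.
by apply: (gt_stable gtP) => //; [apply: wf_literal_mem al|apply: wf_literal_mem bl].
Qed.

Lemma clause_gt_stable sigma C D : is_subst sigma -> wf_clause C -> wf_clause D ->
  clause_gt gt C D -> clause_gt gt (csubst sigma C) (csubst sigma D).
Proof.
move=> ss wC wD; apply: mset_ext_map => l l' /wC wl /wD wl'; exact: lit_gt_stable.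
Qed.

Definition clause_below C t := forall l u, l \in C -> u \in l.2 -> term_le gt u t.

Lemma clause_gt_below C D t : gwf t -> gwf_clause C -> gwf_clause D ->
  clause_gt gt C D -> clause_below C t -> clause_below D t.
Proof.
move=> ggt gC gD /mset_extP[Z [X [Y [_ EC ED XY]]]] CB l u.
move=> lD ul; have gu := gwf_literal_mem (gD _ lD) ul.
move: lD; rewrite ED in_msetD => /orP[lZ|/XY[l1 l1X]].
  by apply: (CB l) => //; rewrite EC in_msetD lZ.
have l1C : l1 \in C by rewrite EC in_msetD l1X orbT.
move/mset_extP => [Z1 [X1 [Y1 [_ E1 E XY1]]]].
have: u \in lit_mset l by rewrite mem_lit_mset.
have l1P v : v \in Z1 `+` X1 -> gwf v /\ term_le gt v t.
  rewrite -E1 mem_lit_mset => vl1; split; first exact: gwf_literal_mem (gC _ l1C) vl1.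
  exact: (CB l1).
rewrite E in_msetD => /orP[uZ|/XY1[v vX gvu]].
  by apply: (proj2 (l1P _ _)); rewrite in_msetD uZ.
have [|gv le_vt] := l1P v; first by rewrite in_msetD vX orbT.
by right; apply: gwf_lt_le_trans gvu le_vt.
Qed.

Lemma lit_gt_dominated l l' w : w \in l.2 -> (forall v, v \in l'.2 -> gt w v) -> lit_gt gt l l'.
Proof.
move=> wl H; apply: (mset_ext_dominated (a := w)); first by rewrite mem_lit_mset.
by move=> b; rewrite mem_lit_mset; apply: H.
Qed.

(** One copy of [u] is kept as the common part and the second dominates [v], whatever [w] is. *)
Lemma lit_gt_neq_eqn u v w : gt u v -> lit_gt gt (neq u w) (eqn u v).
Proof.
move=> guv; apply/mset_extP; exists [mset u], ([mset u] `+` [mset w; w]), [mset v]; split=> //.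
- by move/msetP/(_ u); rewrite !msetE2 !msetnE eqxx mset0E.
- by rewrite /lit_mset /=; apply/msetP => x; rewrite !msetE2; lia.
- by move=> y /mset1P->; exists u => //; rewrite mset1D1.
Qed.

Lemma csubst_lt theta theta' C x : ground_subst theta -> ground_subst theta' ->
  wf_clause C -> (forall x, term_le gt (theta' x) (theta x)) ->
  x \in cvars C -> theta' x <> theta x ->
  clause_gt gt (csubst theta C) (csubst theta' C).
Proof.
move=> gth gth' wC le_th /cvarsP[l [t [lC tl xt]]] ne_x.
have tP u : wf_term u -> tsubst theta u = tsubst theta' u \/ gt (tsubst theta u) (tsubst theta' u).
  by move=> /(tsubst_le gth gth' le_th)[->|]; [left|right].
have lt_l l1 u : wf_literal l1 -> u \in l1.2 -> tsubst theta u <> tsubst theta' u ->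
    lit_gt gt (lsubst theta l1) (lsubst theta' l1).
  move=> wl1 ul1 ne_u; rewrite /lit_gt !lit_mset_lsubst; apply: (mset_ext_map2 (a := u)).
  - by move=> v; rewrite mem_lit_mset => vl1; apply: tP; apply: wf_literal_mem vl1.
  - by rewrite mem_lit_mset.
  - by case: (tP u) => //; apply: wf_literal_mem ul1.
have le_l (l1 : literal S) : l1 \in C ->
    lsubst theta l1 = lsubst theta' l1 \/ lit_gt gt (lsubst theta l1) (lsubst theta' l1).
  move=> l1C; case: (pselect (exists2 u, u \in l1.2 & tsubst theta u <> tsubst theta' u)).
    by case=> u ul1 ne_u; right; apply: lt_l ne_u => //; apply: wC.
  move=> H; left; rewrite /lsubst; congr pair; apply: eq_in_mset_map => u ul1.
  by apply: contrapT => ne_u; apply: H; exists u.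
apply: (mset_ext_map2 (a := l)) => //.
by apply: lt_l tl _; [apply: wC|move=> /tsubst_inj_in/(_ _ xt)/esym].
Qed.

End Orders.

(** * Normal forms and the structure they define *)

Section NormalForms.
Context {S : signature} {gt : term S -> term S -> Prop} {gtP : simplification_order gt}.
Implicit Types (s t u r : term S) (l : literal S) (C D : clause S) (c : context S).
Implicit Types (rho : term S -> option (term S)).

Definition rules_ok rho := forall u r, rho u = Some r ->
  [/\ gwf u, gwf r, gt u r & tsort u = tsort r].

Definition glt t s := [/\ gwf s, gwf t & gt s t].

(** A call outside [glt] returns its argument unchanged. For ground well-sorted [t] and rules
    satisfying [rules_ok] no such call occurs, as [nf_spec] shows. *)
Definition nf_step rho t (rec : forall u, glt u t -> term S) : term S :=
  let rec' u := if pselect (glt u t) is left lt_ut then rec u lt_ut else u in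
  if t is App f ts then
    let w := App f (map rec' ts) in if rho w is Some r then rec' r else w
  else t.

(* Innermost normalisation.  Since the normal form of f(ts) is computed from the
   normal forms of ts, having the same normal form is a congruence for any set
   of rules, so no confluence argument is needed. *)
Definition nf rho : term S -> term S :=
  Fix (gwf_wellfounded gtP : well_founded glt) (fun=> term S) (nf_step rho).

Lemma nf_unfold rho t : nf rho t = @nf_step rho t (fun u _ => nf rho u).
Proof.
apply: (Fix_eq _ (fun=> term S)) => {}t f g E; congr nf_step.
by apply: functional_extensionality_dep => u; apply: functional_extensionality_dep => p.
Qed.

Section Fixed.
Context {rho : term S -> option (term S)} (rok : rules_ok rho).
Local Notation nf := (nf rho).

(** The claims are proved together: the recursive equation needs the right-hand side [r] to be
    smaller than the term, and this rests on the bound for the normal forms of the arguments. *)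
Lemma nf_spec t : gwf t -> [/\ gwf (nf t), tsort (nf t) = tsort t, term_le gt (nf t) t
  & nf t = if t is App f ts then
             let w := App f (map nf ts) in if rho w is Some r then nf r else w
           else t].
Proof.
elim/(well_founded_ind (gwf_wellfounded gtP)): t => t IH ggt.
rewrite nf_unfold; case: t IH ggt => [x _ gx|f ts IH ggt]; first by split=> //; left.
rewrite /nf_step; set rec' := fun u => _.
have rec'E u : glt u (App f ts) -> rec' u = nf u by rewrite /rec'; case: pselect.
have arg t : t \in ts -> glt t (App f ts).
  move=> tts; split=> //; last by apply: gt_arg => //; apply: gwf_wf.
  by move: ggt; rewrite gwf_App => /andP[/allP/(_ _ tts)].
rewrite (_ : map rec' ts = map nf ts); last by apply/eq_in_map => t /arg/rec'E.
have [||gw le_w] := @App_map_le _ _ gtP f ts nf id.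
- move=> t tts; have [g1 g2 lt] := arg _ tts.
  by have [ngt ns nle _] := IH t (arg _ tts) g2; split.
- by rewrite map_id.
rewrite map_id in le_w; case E : (rho _) => [r|]; last by split.
have [_ gr gtr sr] := rok E.
have lt_r : glt r (App f ts) by split=> //; apply: gwf_lt_le_trans gtr le_w.
rewrite -/(rec' r) rec'E //; have [g1 g2 lt_r'] := lt_r; have [ngr nsr nler _] := IH r lt_r gr.
split=> //; first by rewrite nsr -sr.
by right; apply: gwf_le_lt_trans nler lt_r'.
Qed.

Lemma nf_gwf t : gwf t -> gwf (nf t). Proof. by case/nf_spec. Qed.
Lemma nf_sort t : gwf t -> tsort (nf t) = tsort t. Proof. by case/nf_spec. Qed.
Lemma nf_le t : gwf t -> term_le gt (nf t) t. Proof. by case/nf_spec. Qed.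

Lemma nf_AppE f ts : gwf (App f ts) ->
  nf (App f ts) = if rho (App f (map nf ts)) is Some r then nf r else App f (map nf ts).
Proof. by case/nf_spec. Qed.

Lemma gwf_args f ts : gwf (App f ts) -> forall t, t \in ts -> gwf t.
Proof. by rewrite gwf_App => /andP[/allP]. Qed.

Lemma nf_map_args f ts : gwf (App f ts) ->
  gwf (App f (map nf ts)) /\ term_le gt (App f (map nf ts)) (App f ts).
Proof.
move=> gA; have := @App_map_le _ _ gtP f ts nf id; rewrite map_id; apply=> //.
move=> t /(gwf_args gA) ggt; split=> //; [exact: nf_gwf|exact: nf_sort|exact: nf_le].
Qed.

Lemma nf_idem t : gwf t -> nf (nf t) = nf t.
Proof.
elim/(well_founded_ind (gwf_wellfounded gtP)): t => -[x _ gx|f ts IH gA].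
  by have [_ _ _ E] := nf_spec gx; rewrite !E.
have [gw le_w] := nf_map_args gA.
rewrite nf_AppE //; case E : (rho _) => [r|].
  have [_ gr gtr _] := rok E; apply: IH => //; split=> //.
  exact: gwf_lt_le_trans gtr le_w.
rewrite nf_AppE // -map_comp (_ : map (nf \o nf) ts = map nf ts) ?E //.
apply/eq_in_map => t tts /=; have ggt := gwf_args gA tts.
by apply: IH => //; split=> //; apply: gt_arg => //; apply: gwf_wf.
Qed.

Lemma nf_App_nf f ts : gwf (App f ts) -> nf (App f (map nf ts)) = nf (App f ts).
Proof.
move=> gA; have [gw _] := nf_map_args gA; rewrite !nf_AppE // -map_comp.
rewrite (_ : map (nf \o nf) ts = map nf ts) //.
by apply/eq_in_map => t /(gwf_args gA)/nf_idem.
Qed.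

Lemma nf_fill c u u' : gwf (fill c u) -> gwf u' -> tsort u = tsort u' ->
  nf u = nf u' -> nf (fill c u) = nf (fill c u').
Proof.
move=> gc gu' su nu; elim: c gc => //= f ls c IH rs gA.
have gA' : gwf (App f (ls ++ fill c u' :: rs)).
  by apply: (gwf_fill_sub (c := CApp f ls c rs)) gA.
rewrite -nf_App_nf // -[RHS]nf_App_nf // !map_cat /= IH //.
by apply: (gwf_args gA); rewrite mem_cat inE eqxx orbT.
Qed.

Lemma nf_id_args f ts t : gwf (App f ts) -> nf (App f ts) = App f ts -> t \in ts -> nf t = t.
Proof.
move=> gA; rewrite nf_AppE //; have [gw le_w] := nf_map_args gA.
case E : (rho _) => [r|] Er.
  have [_ gr gtr _] := rok E.
  case: (gwf_gt_irr gtP gA); apply: (gwf_lt_le_trans gtP) le_w => //.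
  by rewrite -{1}Er; apply: gwf_le_lt_trans gtr => //; [apply: nf_gwf|apply: nf_le].
move=> tts; have /eq_in_map/(_ _ tts) // : map nf ts = map id ts.
by case: Er => ->; rewrite map_id.
Qed.

Lemma nf_id_fill c u : gwf (fill c u) -> nf (fill c u) = fill c u -> nf u = u.
Proof.
elim: c => //= f ls c IH rs gA nA.
have c_in : fill c u \in ls ++ fill c u :: rs by rewrite mem_cat inE eqxx orbT.
by apply: IH; [apply: (gwf_args gA)|apply: (nf_id_args gA)].
Qed.

Lemma nf_rule f ts r : rho (App f ts) = Some r -> (forall t, t \in ts -> nf t = t) ->
  nf (App f ts) = nf r.
Proof.
move=> E nts; have [gA _ _ _] := rok E; rewrite nf_AppE //.
rewrite (_ : map nf ts = ts) ?E // -[RHS]map_id; exact/eq_in_map.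
Qed.

(** Descend into a non-normal argument as long as there is one; where all arguments are normal, the
    term itself must be a left-hand side. *)
Lemma nf_reducible t : gwf t -> nf t <> t -> exists c u r, t = fill c u /\ rho u = Some r.
Proof.
elim/term_mem_ind: t => [x gx|f ts IH gA nA]; first by have [_ _ _ ->] := nf_spec gx.
case: (pselect (exists2 t, t \in ts & nf t <> t)) => [[t tts nt]|nts].
  have [c [u [r [Et ur]]]] := IH _ tts (gwf_args gA tts) nt.
  case/splitPr: tts {IH gA nA} => ls rs.
  by exists (CApp f ls c rs), u, r; rewrite /= Et.
move: nA; rewrite nf_AppE // (_ : map nf ts = ts).
  by case E : (rho _) => [r|//] _; exists Hole, (App f ts), r.
rewrite -[RHS]map_id; apply/eq_in_map => t tts.
by apply: contrapT => nt; apply: nts; exists t.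
Qed.

(** The common normal form is at most [t], hence strictly below [s]. This turns a true equation into
    a redex in its larger side. *)
Lemma nf_lt s t : gwf s -> gwf t -> gt s t -> nf s = nf t -> nf s <> s.
Proof.
move=> gs ggt gst -> E; apply: (gwf_gt_irr gtP gs); rewrite -{2}E.
by apply: gwf_le_lt_trans gst => //; [apply: nf_gwf|apply: nf_le].
Qed.

Definition ltrue l := exists s t, l.2 = [mset s; t] /\
  if l.1 then nf s = nf t else nf s <> nf t.
Definition ctrue C := exists2 l : literal S, l \in C & ltrue l.

Lemma ltrueE b s t : ltrue (lit b s t) <-> if b then nf s = nf t else nf s <> nf t.
Proof.
split=> [[s' [t' [/= /mset2_inj[[-> ->]|[-> ->]]]]]|] //; last by exists s, t.
by case: b => [->//|H E]; apply: H.
Qed.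

Lemma ctrueD C D : ctrue (C `+` D) <-> ctrue C \/ ctrue D.
Proof.
split=> [[l /msetDP[lC|lD] lt]|]; [by left; exists l|by right; exists l|].
by case=> -[l lC lt]; exists l => //; rewrite in_msetD lC ?orbT.
Qed.

Lemma ctrue1 l : ctrue [mset l] <-> ltrue l.
Proof.
split=> [[l' /mset1P->]//|lt]; exists l => //; exact/mset1P.
Qed.

(** * The structure of normal forms *)

Section Model.
Hypothesis inhS : sorts_inhabited S.

Definition nf_carrier a u := [/\ gwf u, tsort u = a & nf u = u].

Lemma nf_carrier_inhabited a : exists u, nf_carrier a u.
Proof.
have [t [wt ggt st]] := inhS a; have gwt : gwf t by rewrite /gwf wt ggt.
by exists (nf t); split; rewrite ?nf_gwf ?nf_sort ?nf_idem.
Qed.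

Lemma nf_interp_sorted (f : symb S) us : List.Forall2 nf_carrier (dom f) us ->
  nf_carrier (cod f) (nf (App f us)).
Proof.
move=> H; have gA : gwf (App f us).
  rewrite gwf_App; elim: H => //= a u aa us' [gu su _] _ /andP[-> /eqP ->].
  by rewrite gu su eqxx.
by split; rewrite ?nf_gwf ?nf_sort ?nf_idem.
Qed.

Definition nf_structure : structure S :=
  Structure nf_carrier_inhabited nf_interp_sorted.

Lemma eval_nf (v : var S -> univ nf_structure) t :
  (forall x, carrier x.1 (v x)) -> wf_term t -> eval v t = nf (tsubst v t).
Proof.
move=> vc; have gv : ground_subst v by move=> x; case: (vc x).
elim/term_mem_ind: t => [x _|f ts IH wA] /=; first by case: (vc x).
rewrite -[RHS]nf_App_nf; last exact: (gwf_tsubst gv wA).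
congr (nf (App f _)); rewrite -map_comp; apply/eq_in_map => t tts /=; apply: IH => //.
by have /= /andP[/allP/(_ _ tts)] := wA.
Qed.

Lemma models_instances C : wf_clause C ->
  (forall theta, ground_subst theta -> ctrue (csubst theta C)) -> models nf_structure C.
Proof.
move=> wC H v vc; have gv : ground_subst v by move=> x; case: (vc x).
have [_ /mset_mapP[l lC ->]] := H v gv.
have [b [s [t [El ws wt _]]]] := wf_literalP (wC _ lC).
rewrite El lsubst_lit => /ltrueE H'; exists l => //; exists s, t; rewrite El !eval_nf //.
Qed.

(** Any valuation will do, and one exists because every carrier is inhabited; for the empty clause
    this gives the contradiction. *)
Lemma models_valuation C : wf_clause C -> models nf_structure C ->
  exists2 theta, ground_subst theta & ctrue (csubst theta C).
Proof.
move=> wC MC; have [v vc] := choice (fun x : var S => nf_carrier_inhabited x.1).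
have gv : ground_subst v by move=> x; case: (vc x).
exists v => //; have [l lC [s [t [El]]]] := MC v vc.
have ls u : u \in [mset s; t] -> wf_term u by rewrite -El; apply: wf_literal_mem (wC _ lC).
rewrite !eval_nf ?ls ?mset21 ?mset22 // => H.
exists (lsubst v l); first exact: mset_map_f.
by exists (tsubst v s), (tsubst v t); rewrite /= El mset_map2.
Qed.

Lemma csubst_ground theta C : gwf_clause C -> csubst theta C = C.
Proof.
move=> /gwf_clauseP[_ gC]; rewrite -[RHS]csubst_Var; apply: eq_in_csubst => x.
by move: gC; rewrite /ground_clause => /nilP ->.
Qed.

Lemma entails_ctrue (Ds : seq (clause S)) E : (forall D, D \in Ds -> gwf_clause D) ->
  gwf_clause E -> entails (fun D => D \in Ds) E -> (forall D, D \in Ds -> ctrue D) -> ctrue E.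
Proof.
move=> gDs gE ent tDs; have [||theta _] := @models_valuation E.
- by move/gwf_clauseP: gE => [].
- apply: ent => D DDs; apply: models_instances; first by have /gwf_clauseP[] := gDs _ DDs.
  by move=> theta _; rewrite csubst_ground; [apply: tDs|apply: gDs].
by rewrite csubst_ground.
Qed.

End Model.
End Fixed.

(** Normalising [t] only ever consults rules whose left-hand side is at most [t]. All comparisons
    between the model and its approximations come from this. *)
Lemma nf_agree rho1 rho2 t : rules_ok rho1 -> rules_ok rho2 -> gwf t ->
  (forall u, gwf u -> term_le gt u t -> rho1 u = rho2 u) -> nf rho1 t = nf rho2 t.
Proof.
move=> ok1 ok2; elim/(well_founded_ind (gwf_wellfounded gtP)): t => -[x _ gx _|f ts IH gA agr].
  by have [_ _ _ ->] := nf_spec ok1 gx; have [_ _ _ ->] := nf_spec ok2 gx.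
have lt_agr u : glt u (App f ts) -> nf rho1 u = nf rho2 u.
  move=> lt_u; have [_ gu ltu] := lt_u; apply: IH => // v gv le_v; apply: agr => //.
  by right; apply: gwf_le_lt_trans ltu.
have Ets : map (nf rho1) ts = map (nf rho2) ts.
  apply/eq_in_map => t tts; apply: lt_agr; split=> //; first exact: (gwf_args gA).
  by apply: gt_arg => //; apply: gwf_wf.
have [gw le_w] := nf_map_args ok2 gA.
rewrite !nf_AppE // Ets agr //; case E : (rho2 _) => [r|//].
have [_ gr gtr _] := ok2 _ _ E; apply: lt_agr; split=> //.
exact: gwf_lt_le_trans gtr le_w.
Qed.

End NormalForms.

Arguments nf {S gt} gtP rho t.
Arguments ltrue {S gt} gtP rho l.
Arguments ctrue {S gt} gtP rho C.

(** * Lifting of ground inferences *)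

Section Lifting.
Context {S : signature} {gt : term S -> term S -> Prop} (gtP : simplification_order gt).
Context (inhS : sorts_inhabited S).
Context {sel : clause S -> clause S} (selP : selection_function sel).
Context {N : clause S -> Prop} (wfN : forall C, N C -> wf_clause C).
Implicit Types (s t u v : term S) (l : literal S) (C D E : clause S) (c : context S).
Implicit Types (sigma theta : subst S) (p q : @premise S).

Definition represents C (D : clause S) theta := [/\ N D, ground_subst theta & C = csubst theta D].

(** A grounding substitution need only ground the variables of its clause. Sending the others to
    arbitrary ground terms of their sorts makes it ground everywhere. *)
Lemma instances_setP C : instances_set N C <-> exists D theta, represents C D theta.
Proof.
split=> [[D ND [theta [[sp idm] gD] ->]]|[D [theta [ND gth ->]]]].
  have [d dP] := choice inhS.
  pose theta' x := if x \in cvars D then theta x else d x.1.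
  have E : csubst theta D = csubst theta' D.
    by apply: eq_in_csubst => x xD; rewrite /theta' xD.
  exists D, theta'; split=> // x; rewrite /theta'; case: ifP => [xD|_]; last first.
    by have [wd gd sd] := dP x.1; rewrite /gwf wd gd.
  have [wx sx] := sp x; split=> //; rewrite /gwf wx; apply/ground_termP => y; apply/negP => yx.
  have: y \in cvars (csubst theta D).
    have /cvarsP[l [t [lD tl xt]]] := xD.
    apply/cvarsP; exists (lsubst theta l), (tsubst theta t); split; rewrite ?mset_map_f //.
    have [c ->] := mem_tvars_fill xt; rewrite tsubst_fill /=.
    elim: (ctxsubst theta c) => //= f ls c' IH rs.
    by rewrite map_cat flatten_cat /= !mem_cat IH orbT.
  by move: gD; rewrite /ground_clause => /nilP ->.
exists D => //; exists theta => //; split; first exact: ground_is_subst.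
by have /gwf_clauseP[] := gwf_csubst gth (wfN ND).
Qed.

Lemma instances_gwf C : instances_set N C -> gwf_clause C.
Proof.
move=> /instances_setP[D [theta [ND gth ->]]]; exact: gwf_csubst gth (wfN ND).
Qed.

(** The default [(C, Var)] makes [gsel] agree with [sel] outside the instances of [N], because a
    ground selection function must be justified on every ground clause. *)
Definition rep C : clause S * subst S :=
  if pselect (exists p : clause S * subst S, represents C p.1 p.2) is left ex
  then sval (cid ex) else (C, Var).

Lemma repP C : instances_set N C -> represents C (rep C).1 (rep C).2.
Proof.
move=> /instances_setP[D [theta H]]; rewrite /rep; case: pselect => [ex|[]].
  by case: cid.
by exists (D, theta).
Qed.

Definition gsel C := csubst (rep C).2 (sel (rep C).1).

Lemma gsel_ground_selection : ground_selection sel gsel.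
Proof.
move=> C wC gC; exists (rep C).1, (rep C).2; rewrite /gsel /rep; case: pselect => [ex|_].
  case: cid => -[D theta] /= [ND gth EC]; split=> //; first exact: wfN.
  by split; [apply: ground_is_subst|rewrite -EC].
by rewrite /= csubst_Var; split=> //; split; [apply: Var_is_subst|rewrite csubst_Var].
Qed.

Lemma gsel_neg C l : gwf_clause C -> l \in gsel C -> l \in C /\ l.1 = false.
Proof.
move=> gC; rewrite /gsel /rep; case: pselect => [ex|_].
  case: cid => -[D theta] /= [ND gth ->] /mset_mapP[l1 l1s ->].
  have [sub neg] := selP (wfN ND); split; last exact: (neg _ l1s).
  by apply: mset_map_f; exact: (msubset_subset sub l1s).
rewrite /= csubst_Var => lC; have [sub neg] := selP (proj1 (iffLR (gwf_clauseP C) gC)).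
by split; [exact: (msubset_subset sub lC)|apply: neg].
Qed.

Definition lifts p theta C :=
  [/\ N (parent p), is_renaming (ren p), ground_subst theta, csubst theta (variant p) = C
    & csubst theta (selected sel p) = gsel C].

Lemma renaming_sorted (r : var S -> var S) : is_renaming r -> sort_preserving (Var \o r).
Proof. by move=> [_ sr] x; split=> //=. Qed.

Lemma wf_variant p theta C : lifts p theta C -> wf_clause (variant p).
Proof. by move=> [Np rp _ _ _]; apply: wf_csubst; [apply: renaming_sorted|apply: wfN]. Qed.

Lemma lifts_rep C : instances_set N C -> lifts (Premise (rep C).1 id) (rep C).2 C.
Proof.
move=> /repP[ND gth EC]; split=> //; rewrite /variant /selected /=.
- by split=> // x y.
- by rewrite [RHS]EC; apply: csubst_comp.
- by rewrite /gsel; apply: csubst_comp.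
Qed.

(** Common form of [eligible], with [bad] the relation [lit_gt], and of [strictly_eligible], with
    [bad] the converse of [lit_le]; one lifting lemma then serves both. *)
Definition eligible_for (bad : literal S -> literal S -> Prop) (L : clause S) sigma C' l :=
  l \in L \/ L = mset0 /\ forall l', l' \in C' -> ~ bad (lsubst sigma l') (lsubst sigma l).

Definition stable_rel (bad : literal S -> literal S -> Prop) := forall theta l l',
  is_subst theta -> wf_literal l -> wf_literal l' -> bad l l' ->
  bad (lsubst theta l) (lsubst theta l').

Definition absorbs theta sigma := is_subst sigma /\ forall x, tsubst theta (sigma x) = theta x.

Lemma absorbs_Var theta : absorbs theta Var.
Proof. by split=> //; apply: Var_is_subst. Qed.

Lemma wf_lsubst sigma l : sort_preserving sigma -> wf_literal l -> wf_literal (lsubst sigma l).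
Proof.
move=> sp /wf_literalP[b [s [t [-> ws wt st]]]]; rewrite lsubst_lit.
by exists (tsubst sigma s), (tsubst sigma t); split; rewrite ?wf_tsubst // !tsort_tsubst.
Qed.

(** The literal is fixed before [sigma], since [sigma] will depend on its shape. If [l] is selected,
    a selected preimage has to be taken; otherwise any preimage works, as [bad] between
    [sigma]-instances would persist under [theta]. *)
Lemma lift_literal bad p theta C l C' : stable_rel bad -> lifts p theta C ->
  C = l +` C' -> eligible_for bad (gsel C) Var C' l ->
  exists l1 C1, [/\ variant p = l1 +` C1, lsubst theta l1 = l, csubst theta C1 = C'
    & forall sigma, absorbs theta sigma -> eligible_for bad (selected sel p) sigma C1 l1].
Proof.
move=> bstab lp EC; have wp := wf_variant lp; case: lp => Np rp gth Ep Es.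
rewrite -Es => -[/mset_mapP[l1 l1s El]|[s0 max_l]].
  have l1p : l1 \in variant p.
    case/mset_mapP: l1s => l0 l0s ->; apply: mset_map_f.
    by have [sub _] := selP (wfN Np); exact: (msubset_subset sub l0s).
  have [C1 E1 E2] := mset_map_splitW (etrans Ep EC) l1p (esym El).
  by exists l1, C1; split=> // sigma _; left.
have [l1 [C1 [E1 E2 E3]]] := mset_map_split (etrans Ep EC).
exists l1, C1; split=> // sigma [ss ab]; right; split; first exact: mset_map_eq0 s0.
move=> l' l'C1 /(bstab theta).
have wl' : wf_literal l' by apply: wp; rewrite E1 mset1Dr.
have wl1 : wf_literal l1 by apply: wp; rewrite E1 mset1D1.
have [sp _] := ss.
rewrite !(lsubst_comp _ ab) E2.
move=> /(_ (ground_is_subst gth) (wf_lsubst sp wl') (wf_lsubst sp wl1)).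
have := max_l (lsubst theta l'); rewrite !lsubst_Var; apply.
by rewrite -E3 mset_map_f.
Qed.

Lemma lit_gt_stable_rel : stable_rel (lit_gt gt).
Proof. by move=> theta l l' ss wl wl'; apply: lit_gt_stable. Qed.

Lemma lit_le_stable_rel : stable_rel (fun l' l => lit_le gt l l').
Proof.
move=> theta l l' ss wl wl' [->|H]; [by left|right]; exact: lit_gt_stable.
Qed.

Lemma gt_not_le theta sigma s t : ground_subst theta -> absorbs theta sigma ->
  wf_term s -> wf_term t -> gt (tsubst theta s) (tsubst theta t) ->
  ~ term_le gt (tsubst sigma s) (tsubst sigma t).
Proof.
move=> gth [[sp _] ab] ws wt gst.
have E u : tsubst theta u = tsubst theta (tsubst sigma u).
  by rewrite tsubst_comp; apply: esym; apply: eq_tsubst.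
case=> [st|gts].
  by apply: (gwf_gt_irr gtP (gwf_tsubst gth ws)); rewrite {2}(E s) st -E.
apply: (gwf_gt_asym gtP (gwf_tsubst gth ws) (gwf_tsubst gth wt) gst); rewrite (E s) (E t).
by apply: (gt_stable gtP) => //; rewrite ?wf_tsubst //; apply: ground_is_subst.
Qed.

Lemma clause_gt_not_le theta sigma C D : ground_subst theta -> absorbs theta sigma ->
  wf_clause C -> wf_clause D -> clause_gt gt (csubst theta C) (csubst theta D) ->
  ~ clause_le gt (csubst sigma C) (csubst sigma D).
Proof.
move=> gth [[sp _] ab] wC wD gCD.
have gC := gwf_csubst gth wC; have gD := gwf_csubst gth wD.
have E X : csubst theta X = csubst theta (csubst sigma X).
  by apply: esym; apply: csubst_comp.
case=> [CD|gDC].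
  by apply: (clause_gt_asym gtP gC gD gCD); move: gCD; rewrite (E C) (E D) CD.
apply: (clause_gt_asym gtP gC gD gCD); rewrite (E C) (E D).
by apply: clause_gt_stable => //; [apply: ground_is_subst|apply: wf_csubst..].
Qed.

(** * Lifting of the individual ground rules *)

Context (sat : saturated gt sel N).

Lemma lift_inference i ig theta : Inf gt sel i ->
  (forall p, List.In p (prems i) -> N (parent p)) -> GInf gt gsel ig -> ground_subst theta ->
  gprems ig = [seq csubst theta (variant p) | p <- prems i] ->
  gconcl ig = csubst theta (main i) -> GRed_I gt gsel (instances_set N) ig.
Proof.
move=> iI Ni gi gth E1 E2; have [_ red] := sat iI Ni.
apply: red; first exact: gsel_ground_selection.
by split=> //; exists theta; split=> //; apply: ground_is_subst.
Qed.

Lemma lift_inference1 p m cs C E theta : lifts p theta C -> rule gt sel (Inference [:: p] m cs) ->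
  ground_rule gt gsel (GroundInference [:: C] E) -> gwf_clause C ->
  csubst theta m = E -> GRed_I gt gsel (instances_set N) (GroundInference [:: C] E).
Proof.
move=> [Np rp gth EC _] ir gr gC Em.
apply: (lift_inference (i := Inference [:: p] m cs) (theta := theta)) => //=.
- by split=> //= p' [<-|].
- by move=> p' [<-|].
- by split=> //= D; rewrite inE => /eqP->; apply/gwf_clauseP.
- by rewrite EC.
Qed.

(** The two sides have the same [theta]-instance: if identical they allow [ReflDel], if one is a
    variable [Bind], and two distinct applications share their head symbol, as [Decompose]
    requires. *)
Lemma lift_GEqRes C C' s : instances_set N C -> C = neq s s +` C' ->
  eligible gt (gsel C) Var C' (neq s s) ->
  GRed_I gt gsel (instances_set N) (GroundInference [:: C] C').
Proof.
move=> iC EC el; have gC := instances_gwf iC.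
have gr : ground_rule gt gsel (GroundInference [:: C] C').
  by rewrite EC; apply: GEqRes; rewrite -EC.
have lp := lifts_rep iC; move: (Premise _ _) (rep C).2 lp => p theta lp.
have [l1 [C1 [Ep El EC' el1]]] := lift_literal lit_gt_stable_rel lp EC el.
have wl1 : wf_literal l1 by apply: (wf_variant lp); rewrite Ep mset1D1.
have gth : ground_subst theta by case: lp.
have [s1 [s2 [El1 E1 E2]]] := lsubst_lit_inv wl1 El; subst l1.
have [w1 w2 ss12] := wf_lit wl1.
have [E12|/eqP ne12] := eqVneq s1 s2.
  subst s2; apply: (lift_inference1 lp) gr gC EC'.
  by apply: (ReflDel (s := s1)) => //; apply: el1; apply: absorbs_Var.
have bind x t : variant p = neq (Var x) t +` C1 -> wf_term t -> tsort t = x.1 ->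
    t <> Var x -> theta x = tsubst theta t ->
    (forall sigma, absorbs theta sigma ->
       eligible_for (lit_gt gt) (selected sel p) sigma C1 (neq (Var x) t)) ->
    GRed_I gt gsel (instances_set N) (GroundInference [:: C] C').
  move=> Ep' wt st ne_t xt el'.
  have x_nt : x \notin tvars t.
    by apply/negP => /(occurs_check gtP gth wt xt).
  have ab : absorbs theta (single x t).
    by split; [apply: is_subst_single => //; left|apply: tsubst_single].
  apply: (lift_inference1 lp _ gr gC); last first.
    by rewrite -EC'; apply: csubst_comp (proj2 ab).
  exact: (Bind Ep' x_nt (el' _ ab)).
case: s1 s2 E1 E2 Ep el1 w1 w2 ss12 ne12 {El wl1} => [x|f ss] s2 E1 E2 Ep el1 w1 w2 ss12 ne12.
  apply: (bind x s2) => //; first by move=> E; apply: ne12; rewrite E.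
  by rewrite -[LHS]/(tsubst theta (Var x)) E1 E2.
case: s2 E2 Ep el1 w2 ss12 ne12 => [x|g ts] E2 Ep el1 w2 ss12 ne12.
  rewrite (litC false (App f ss)) in Ep el1.
  apply: (bind x (App f ss) Ep w1 ss12 _ _ el1); first exact: ne12.
  by rewrite E1 -E2.
have Efg : g = f by move: E2; rewrite -E1 => -[].
subst g; apply: (lift_inference1 lp) gr gC EC'.
exact: (Decompose Ep ne12 (el1 _ (absorbs_Var _))).
Qed.

Lemma lift_GEqFact C C' u v v' : instances_set N C -> C = eqn u v +` (eqn u v' +` C') ->
  eligible gt (gsel C) Var (eqn u v' +` C') (eqn u v) -> gt u v -> gt u v' ->
  GRed_I gt gsel (instances_set N) (GroundInference [:: C] (C' `+` [mset neq v v'; eqn u v])).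
Proof.
move=> iC EC el guv guv'; have gC := instances_gwf iC.
have gr : ground_rule gt gsel (GroundInference [:: C] (C' `+` [mset neq v v'; eqn u v])).
  move: (el); rewrite EC => el'; exact: (GEqFact el' guv guv').
have lp := lifts_rep iC; move: (Premise _ _) (rep C).2 lp => p theta lp.
have [l1 [C1 [Ep El EC1 el1]]] := lift_literal lit_gt_stable_rel lp EC el.
have [l2 [C2 [E2 El2 EC2]]] := mset_map_split EC1; subst C1.
have wp := wf_variant lp.
have wl1 : wf_literal l1 by apply: wp; rewrite Ep mset1D1.
have wl2 : wf_literal l2 by apply: wp; rewrite Ep mset1Dr // mset1D1.
have gth : ground_subst theta by case: lp.
have [u1 [v1 [El1 Eu1 Ev1]]] := lsubst_lit_inv wl1 El; subst l1.
have [u2 [v2 [El2' Eu2 Ev2]]] := lsubst_lit_inv wl2 El2; subst l2.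
have [wu1 wv1 s1] := wf_lit wl1; have [wu2 wv2 s2] := wf_lit wl2.
have nle1 sigma (ab : absorbs theta sigma) : ~ term_le gt (tsubst sigma u1) (tsubst sigma v1).
  by apply: gt_not_le gth ab wu1 wv1 _; rewrite Eu1 Ev1.
have nle2 sigma (ab : absorbs theta sigma) : ~ term_le gt (tsubst sigma u2) (tsubst sigma v2).
  by apply: gt_not_le gth ab wu2 wv2 _; rewrite Eu2 Ev2.
have concl : csubst theta (C2 `+` [mset neq v1 v2; eqn u1 v1]) = C' `+` [mset neq v v'; eqn u v].
  by rewrite /csubst mset_mapD EC2 mset_map2 !lsubst_lit Eu1 Ev1 Ev2.
have vcase sigma : is_var u1 || is_var u2 -> is_mgu sigma u1 u2 -> absorbs theta sigma ->
    GRed_I gt gsel (instances_set N) (GroundInference [:: C] (C' `+` [mset neq v v'; eqn u v])).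
  move=> vu mgu ab; apply: (lift_inference1 lp _ gr gC); last first.
    by rewrite -concl; apply: csubst_comp (proj2 ab).
  exact: (VEqFact Ep vu mgu (el1 _ ab) (nle1 _ ab) (nle2 _ ab)).
have E12 : tsubst theta u1 = tsubst theta u2 by rewrite Eu1 Eu2.
have s12 : tsort u1 = tsort u2.
  by have sp := ground_subst_sorted gth; rewrite -(tsort_tsubst u1 sp) E12 tsort_tsubst.
have bind x t : wf_term t -> tsort t = x.1 -> theta x = tsubst theta t ->
    absorbs theta (single x t) /\ is_mgu (single x t) (Var x) t /\ is_mgu (single x t) t (Var x).
  move=> wt st xt.
  have x_t : x \notin tvars t \/ t = Var x.
    by have [/(occurs_check gtP gth wt xt)|] := boolP (x \in tvars t); [right|left].
  have ss := is_subst_single wt st x_t.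
  have sE : tsubst (single x t) t = t.
    case: x_t => [x_t|->]; last by rewrite /= /single eqxx.
    rewrite -[RHS]tsubst_Var; apply: eq_in_tsubst => y yt; rewrite /single.
    by case: eqP => // yx; rewrite yx (negPf x_t) in yt.
  split; first by split=> //; apply: tsubst_single.
  have xE : tsubst (single x t) (Var x) = t by rewrite /= /single eqxx.
  (* A unifier [tau] factors through the binding with [tau] itself as second factor. *)
  split; split=> //; rewrite ?sE ?xE // => tau [sp _] E; exists tau => // y;
    by rewrite tsubst_single.
case: u1 u2 E12 s12 bind vcase wu1 wu2 Ep el1 nle1 nle2 concl {El El2 wl1 wl2 EC1 Eu1 Eu2 s1 s2}
  => [x|f ss] u2 E12 s12 bind vcase wu1 wu2 Ep el1 nle1 nle2 concl.
  have [ab [mgu _]] := bind x u2 wu2 (esym s12) E12.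
  exact: (vcase (single x u2)).
case: u2 E12 s12 vcase wu2 Ep el1 nle2 concl => [x|g ts] E12 s12 vcase wu2 Ep el1 nle2 concl.
  have [ab [_ mgu]] := bind x (App f ss) wu1 s12 (esym E12).
  exact: (vcase (single x (App f ss))).
have Efg : g = f by case: E12.
subst g; apply: (lift_inference1 lp _ gr gC concl).
have := nle1 _ (absorbs_Var _); have := nle2 _ (absorbs_Var _); rewrite !tsubst_Var => n2 n1.
exact: (EqFact Ep (el1 _ (absorbs_Var _)) n1 n2).
Qed.

(** Even and odd indices rename two premises apart, and a single substitution can serve both by
    reading the parity. *)
Definition evar (x : var S) : var S := (x.1, x.2.*2).
Definition ovar (x : var S) : var S := (x.1, x.2.*2.+1).

Lemma evar_renaming : is_renaming evar.
Proof. by split=> // -[a n] [b m] [-> /double_inj->]. Qed.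

Lemma ovar_renaming : is_renaming ovar.
Proof. by split=> // -[a n] [b m] [-> /double_inj->]. Qed.

Lemma cvars_renamed (r : var S -> var S) C x : x \in cvars (csubst (Var \o r) C) ->
  exists2 y, y \in cvars C & x = r y.
Proof.
case/cvarsP => _ [_ [/mset_mapP[l lC ->] /mset_mapP[t tl ->]]].
have -> : tvars (tsubst (Var \o r) t) = map r (tvars t).
  elim/term_mem_ind: t {tl} => //= f ts IH; rewrite map_flatten -!map_comp.
  by congr flatten; apply/eq_in_map.
by case/mapP => y yt ->; exists y => //; apply/cvarsP; exists l, t.
Qed.

(** The last hypothesis keeps the rewritten position out of the images of variables, so it comes
    from an application in the right premise. The term that it meets in the left premise is an
    application with the same head ([Sup]) or a variable ([VSup]). *)
Lemma lift_GSup C D C' D' t t' b c s' : instances_set N C -> instances_set N D ->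
  D = eqn t t' +` D' -> C = lit b (fill c t) s' +` C' ->
  strictly_eligible gt (gsel D) Var D' (eqn t t') ->
  sup_eligible gt (gsel C) Var C' (lit b (fill c t) s') ->
  gt t t' -> gt (fill c t) s' -> clause_gt gt C D ->
  (forall x c1, x \in cvars (rep C).1 -> (rep C).2 x <> fill c1 t) ->
  GRed_I gt gsel (instances_set N)
    (GroundInference [:: D; C] (C' `+` D' `+` [mset lit b (fill c t') s'])).
Proof.
move=> iC iD ED EC elD elC gtt gcs gCD noVar.
have gC := instances_gwf iC; have gD := instances_gwf iD.
have gi : GInf gt gsel (GroundInference [:: D; C] (C' `+` D' `+` [mset lit b (fill c t') s'])).
  split; first by move=> X; rewrite !inE => /orP[]/eqP->; apply/gwf_clauseP.
  move: (elD) (elC) (gCD); rewrite ED EC => elD' elC' gCD'.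
  exact: (GSup elD' elC' gtt gcs gCD').
have [NC gthC EC0] := repP iC; have [ND gthD ED0] := repP iD.
pose theta (x : var S) := if odd x.2 then (rep C).2 (x.1, x.2./2) else (rep D).2 (x.1, x.2./2).
have gth : ground_subst theta.
  by move=> [a n]; rewrite /theta; case: odd; [have := gthC (a, n./2)|have := gthD (a, n./2)].
have thE x : theta (evar x) = (rep D).2 x.
  by case: x => a n; rewrite /theta /= odd_double doubleK.
have thO x : theta (ovar x) = (rep C).2 x.
  by case: x => a n; rewrite /theta /= odd_double /= uphalf_double.
pose p := Premise (rep D).1 evar; pose q := Premise (rep C).1 ovar.
have lp : lifts p theta D.
  split=> //; [exact: evar_renaming|rewrite [RHS]ED0|]; exact: csubst_comp.
have lq : lifts q theta C.
  split=> //; [exact: ovar_renaming|rewrite [RHS]EC0|]; exact: csubst_comp.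
have noVar' x c1 : x \in cvars (variant q) -> theta x <> fill c1 t.
  by case/cvars_renamed => y yC ->; rewrite thO; apply: noVar.
have apart x : x \in cvars (variant p) -> x \notin cvars (variant q).
  case/cvars_renamed => y _ ->; apply/negP => /cvars_renamed[z _] [_].
  by move/(congr1 odd); rewrite /= !odd_double.
have [l2 [D1 [Ep El2 ED1 el2]]] := lift_literal lit_le_stable_rel lp ED elD.
have [l1 [C1 [Eq El1 EC1 el1]]] : exists l1 C1,
    [/\ variant q = l1 +` C1, lsubst theta l1 = lit b (fill c t) s', csubst theta C1 = C'
      & forall sigma, absorbs theta sigma -> sup_eligible gt (selected sel q) sigma C1 l1].
  case: b EC elC {gi} => EC elC.
    have [l1 [C1 [E1 E2 E3 E4]]] := lift_literal lit_le_stable_rel lq EC elC.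
    by exists l1, C1; split=> //; rewrite /sup_eligible (congr1 fst E2 : l1.1 = true).
  have [l1 [C1 [E1 E2 E3 E4]]] := lift_literal lit_gt_stable_rel lq EC elC.
  by exists l1, C1; split=> //; rewrite /sup_eligible (congr1 fst E2 : l1.1 = false).
have wp := wf_variant lp; have wq := wf_variant lq.
have wl1 : wf_literal l1 by apply: wq; rewrite Eq mset1D1.
have wl2 : wf_literal l2 by apply: wp; rewrite Ep mset1D1.
have [s1 [s2 [El1' Es1 Es2]]] := lsubst_lit_inv wl1 El1; subst l1.
have [t1 [t2 [El2' Et1 Et2]]] := lsubst_lit_inv wl2 El2; subst l2.
have [ws1 ws2 ss12] := wf_lit wl1; have [wt1 wt2 st12] := wf_lit wl2.
have var_s1 x : x \in tvars s1 -> x \in cvars (variant q).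
  by move=> xs; apply/cvarsP; exists (lit b s1 s2), s1; rewrite Eq mset1D1 mset21.
have cond sigma : absorbs theta sigma -> sup_conditions gt sel sigma p q D1 t1 t2 C1 b s1 s2.
  move=> ab; split=> //; split=> //; split=> //; split; first exact: el2.
  split; first exact: el1.
  split; first by apply: gt_not_le gth ab wt1 wt2 _; rewrite Et1 Et2.
  split; first by apply: gt_not_le gth ab ws1 ws2 _; rewrite Es1 Es2.
  apply: clause_gt_not_le gth ab wq wp _.
  by case: lp => _ _ _ -> _; case: lq => _ _ _ -> _.
case: (tsubst_eq_fill Es1) => [[c1 [u1 [Es1' nv Eu1 Ec1]]]|[x [c1 [xs xc]]]]; last first.
  by case: (noVar' x c1) => //; apply: var_s1.
have concl : csubst theta (C1 `+` D1 `+` [mset lit b (fill c1 t2) s2]) =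
    C' `+` D' `+` [mset lit b (fill c t') s'].
  by rewrite !csubstD csubst1 EC1 ED1 lsubst_lit tsubst_fill Et2 Es2 Ec1.
have finish m cs : rule gt sel (Inference [:: p; q] m cs) ->
    csubst theta m = C' `+` D' `+` [mset lit b (fill c t') s'] ->
    GRed_I gt gsel (instances_set N)
      (GroundInference [:: D; C] (C' `+` D' `+` [mset lit b (fill c t') s'])).
  move=> ir Em; apply: (lift_inference (i := Inference [:: p; q] m cs)) gi gth _ _ => //=.
  - by split=> //= p' [<-|[<-|]] //; [apply: evar_renaming|apply: ovar_renaming].
  - by move=> p' [<-|[<-|]].
  - by case: lp => _ _ _ -> _; case: lq => _ _ _ -> _.
case: u1 Es1' nv Eu1 => [//|f ss] Es1' _ Eu1; subst s1.
case: t1 Et1 Ep wt1 st12 cond {El2 wl2 el2} => [x|g ts] Et1 Ep wt1 st12 cond; last first.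
  have Egf : g = f by move: Et1; rewrite -Eu1 => -[].
  subst g; apply: finish concl; exact: (Sup (cond _ (absorbs_Var _))).
have wA := wf_fill ws1.
have xA : theta x = tsubst theta (App f ss) by rewrite Eu1 -Et1.
have ab : absorbs theta (single x (App f ss)).
  split; last exact: tsubst_single.
  apply: is_subst_single => //.
    have sp := ground_subst_sorted gth.
    by rewrite -(tsort_tsubst (App f ss) sp) -xA; case: (sp x).
  (* [x] belongs to the left premise and [App f ss] to the right one, which shares no variable with
     it; hence the binding is idempotent. *)
  left; apply/negP => xss.
  have /apart/negP : x \in cvars (variant p).
    by apply/cvarsP; exists (eqn (Var x) t2), (Var x); rewrite Ep mset1D1 mset21 /= inE.
  apply; apply: var_s1.
  by elim: (c1) => //= h ls c' IH rs; rewrite map_cat flatten_cat /= !mem_cat IH orbT.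
apply: finish (VSup (proj1 ab) (cond _ ab)) _.
by rewrite -concl; apply: csubst_comp (proj2 ab).
Qed.

End Lifting.

(** * The candidate model *)

Section Completeness.
Context {S : signature} {gt : term S -> term S -> Prop} (gtP : simplification_order gt).
Context (inhS : sorts_inhabited S).
Context {sel : clause S -> clause S} (selP : selection_function sel).
Context {N : clause S -> Prop} (wfN : forall C, N C -> wf_clause C).
Implicit Types (s t u v w r : term S) (l k : literal S) (C D E : clause S) (c : context S).
Implicit Types (J : term S -> option (term S)).

Local Notation nf := (nf gtP).
Local Notation ctrue := (ctrue gtP).
Local Notation ltrue := (ltrue gtP).
Local Notation gsel := (@gsel S sel N).
Local Notation rep := (@rep S N).
Local Notation GN := (instances_set N).
Local Notation glt := (@glt S gt).
Local Notation clause_below := (@clause_below S gt).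
Local Notation rules_ok := (@rules_ok S gt).

Definition add_rule J t t' : term S -> option (term S) :=
  fun u => if u == t then Some t' else J u.

(** [prod_rest] is tested after adding the rule, because the rule itself can make another equation
    [eqn t w] of [D'] true. Clauses rejected for this reason are the ones that [GEqFact] handles. *)
Record produces J t t' D D' : Prop := Produces {
  prod_inst : GN D;
  prod_eq : D = eqn t t' +` D';
  prod_gt : gt t t';
  prod_below : clause_below D t;
  prod_false : ~ ctrue J D;
  prod_min : forall C, GN C -> clause_gt gt D C -> ctrue J C;
  prod_elig : strictly_eligible gt (gsel D) Var D' (eqn t t');
  prod_irred : nf J t = t;
  prod_rest : ~ ctrue (add_rule J t t') D'
}.

Definition restrict t (rec : forall u, glt u t -> option (term S)) : term S -> option (term S) :=
  fun u => if pselect (glt u t) is left lt_ut then rec u lt_ut else None.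

Definition model_step t (rec : forall u, glt u t -> option (term S)) : option (term S) :=
  if pselect (exists t' D D', produces (restrict rec) t t' D D') is left ex
  then Some (sval (cid ex)) else None.

(* The candidate model is built by recursion on the left-hand sides of its rules.
   The clause producing a rule for t is a minimal one among the clauses falsified
   by the rules below t, so it is never redundant. *)
Definition model : term S -> option (term S) :=
  Fix (gwf_wellfounded gtP : well_founded glt) (fun=> option (term S)) model_step.

Definition below t : term S -> option (term S) := @restrict t (fun u _ => model u).

Lemma model_unfold t : model t = @model_step t (fun u _ => model u).
Proof.
apply: (Fix_eq _ (fun=> option (term S))) => {}t f g E; congr model_step.
by apply: functional_extensionality_dep => u; apply: functional_extensionality_dep => h.
Qed.

Lemma model_Some t t' : model t = Some t' -> exists D D', produces (below t) t t' D D'.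
Proof. by rewrite model_unfold /model_step; case: pselect => // ex [<-]; case: cid. Qed.

Lemma model_None t t' D D' : model t = None -> ~ produces (below t) t t' D D'.
Proof.
rewrite model_unfold /model_step; case: pselect => // nex _ H; apply: nex.
by exists t', D, D'.
Qed.

Lemma produces_gwf J t t' D D' : produces J t t' D D' ->
  [/\ gwf t, gwf t', tsort t = tsort t' & gwf_clause D].
Proof.
case=> iD ED _ _ _ _ _ _ _; have gD := instances_gwf inhS wfN iD.
by have [|gt1 gt2 st] := @gwf_lit _ true t t'; first by apply: gD; rewrite ED mset1D1.
Qed.

Lemma model_ok : rules_ok model.
Proof.
move=> u r /model_Some[D [D' H]]; have [gu gr sr _] := produces_gwf H.
by split=> //; apply: prod_gt H.
Qed.

Lemma below_lt t u : glt u t -> below t u = model u.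
Proof. by rewrite /below /restrict; case: pselect. Qed.

Lemma below_top t : gwf t -> below t t = None.
Proof.
move=> ggt; rewrite /below /restrict; case: pselect => // -[_ _].
by move/(gwf_gt_irr gtP ggt).
Qed.

Lemma below_ok t : rules_ok (below t).
Proof.
by move=> u r; rewrite /below /restrict; case: pselect => // _; apply: model_ok.
Qed.

Lemma add_rule_ok J t t' : rules_ok J -> gwf t -> gwf t' -> gt t t' -> tsort t = tsort t' ->
  rules_ok (add_rule J t t').
Proof.
by move=> ok ? ? ? ? u r; rewrite /add_rule; case: eqP => [-> [<-]|_ /ok].
Qed.

(** * Normal forms in the model and in its approximations *)

Lemma nf_below t v : gwf t -> gwf v -> gt t v -> nf (below t) v = nf model v.
Proof.
move=> ggt gv gtv; apply: nf_agree => //; [exact: below_ok|exact: model_ok|].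
by move=> u gu le_uv; apply: below_lt; split=> //; apply: gwf_le_lt_trans gtv.
Qed.

Lemma nf_add_rule_lt t t' v : gwf t -> gwf t' -> gt t t' -> tsort t = tsort t' ->
  gwf v -> gt t v -> nf (add_rule (below t) t t') v = nf model v.
Proof.
move=> ggt gt' gtt st gv gtv; apply: nf_agree => //; [|exact: model_ok|].
  by apply: add_rule_ok => //; apply: below_ok.
move=> u gu le_uv; have lt_ut := gwf_le_lt_trans gtP gu gv ggt le_uv gtv.
rewrite /add_rule; case: eqP => [E|_]; last exact: below_lt.
by subst u; case: (gwf_gt_irr gtP ggt).
Qed.

(** If [t] gets no rule, the approximation is already final up to and including [t]. This serves
    clauses that fail to produce, as [nf_add_rule_model] serves those that do. *)
Lemma nf_below_None t v : gwf t -> model t = None -> gwf v -> term_le gt v t ->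
  nf (below t) v = nf model v.
Proof.
move=> ggt tN gv le_vt; apply: nf_agree => //; [exact: below_ok|exact: model_ok|].
move=> u gu le_uv; case: (gwf_le_trans gtP gu gv ggt le_uv le_vt) => [->|lt_ut].
  by rewrite below_top.
exact: below_lt.
Qed.

Lemma nf_add_rule_model t t' v : gwf t -> model t = Some t' -> gwf v -> term_le gt v t ->
  nf (add_rule (below t) t t') v = nf model v.
Proof.
move=> ggt tE gv le_vt; have [_ gt' gtt st] := model_ok tE.
apply: nf_agree => //; [|exact: model_ok|].
  by apply: add_rule_ok => //; apply: below_ok.
move=> u gu le_uv; rewrite /add_rule; case: eqP => [->//|ne_ut].
case: (gwf_le_trans gtP gu gv ggt le_uv le_vt) => // lt_ut.
exact: below_lt.
Qed.

(** Innermost normalisation reaches the new rule only if the arguments of [t] are normal, which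
    irreducibility of [t] supplies. *)
Lemma nf_add_rule_top t t' : gwf t -> gwf t' -> gt t t' -> tsort t = tsort t' ->
  nf (below t) t = t -> nf (add_rule (below t) t t') t = nf model t'.
Proof.
move=> ggt gt' gtt st irr.
have ok : rules_ok (add_rule (below t) t t') by apply: add_rule_ok => //; apply: below_ok.
rewrite -(nf_add_rule_lt ggt gt' gtt st gt' gtt).
case: t ggt gtt st irr ok => [x /andP[_ /ground_termP/(_ x)]|f ts ggt gtt st irr ok].
  by rewrite inE eqxx.
apply: nf_rule => //; first by rewrite /add_rule eqxx.
move=> u uts; have gu := gwf_args ggt uts.
have lt_u : gt (App f ts) u by apply: gt_arg => //; apply: gwf_wf.
rewrite nf_add_rule_lt // -(nf_below ggt gu lt_u).
exact: (nf_id_args (below_ok (t := App f ts)) ggt irr uts).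
Qed.

Lemma nf_model_rule u r : model u = Some r -> nf model u = nf model r.
Proof.
move=> ur; have [gu gr gur sr] := model_ok ur; have [D [D' H]] := model_Some ur.
rewrite -(nf_add_rule_model gu ur gu); last by left.
exact: nf_add_rule_top (prod_irred H).
Qed.

Lemma ltrue_agree J1 J2 l : (forall v, v \in l.2 -> nf J1 v = nf J2 v) ->
  ltrue J1 l -> ltrue J2 l.
Proof.
move=> E [s [t [El H]]]; exists s, t; split=> //.
by rewrite -!E // El ?mset21 ?mset22.
Qed.

Lemma ctrue_agree J1 J2 C : (forall l v, l \in C -> v \in l.2 -> nf J1 v = nf J2 v) ->
  ctrue J1 C -> ctrue J2 C.
Proof.
by move=> E [l lC lt]; exists l => //; apply: ltrue_agree lt => v; apply: E.
Qed.

(** * Producing clauses *)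

Lemma gsel_pos C l : GN C -> l.1 -> l \notin gsel C.
Proof.
move=> iC pos; apply/negP => /(gsel_neg selP wfN (instances_gwf inhS wfN iC))[_ neg].
by rewrite neg in pos.
Qed.

(** An equation is never selected, so its strict eligibility is strict maximality, which totality
    turns into domination. *)
Lemma produces_max J t t' D D' : produces J t t' D D' ->
  forall k, k \in D' -> lit_gt gt (eqn t t') k.
Proof.
move=> H k kD'; have [_ _ _ gD] := produces_gwf H.
have E := prod_eq H; have gk : gwf_literal k by apply: gD; rewrite E mset1Dr.
have gl : gwf_literal (eqn t t') by apply: gD; rewrite E mset1D1.
case: (prod_elig H) => [|[_ /(_ k kD')]].
  by rewrite (negPf (gsel_pos (prod_inst H) _)).
rewrite !lsubst_Var => nle; case: (lit_gt_total gtP gl gk) => // [Elk|gkl]; case: nle.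
  by left.
by right.
Qed.

Lemma produces_true u r D D' : model u = Some r -> produces (below u) u r D D' -> ctrue model D.
Proof.
move=> ur H; exists (eqn u r); first by rewrite (prod_eq H) mset1D1.
by apply/ltrueE; apply: nf_model_rule.
Qed.

Lemma produces_rest u r D D' : model u = Some r -> produces (below u) u r D D' -> ~ ctrue model D'.
Proof.
move=> ur H; have [gu _ _ gD] := produces_gwf H.
move=> tD'; apply: (prod_rest H); apply: ctrue_agree tD' => l v lD' vl.
have lD : l \in D by rewrite (prod_eq H) mset1Dr.
rewrite (nf_add_rule_model gu ur) //; first exact: gwf_literal_mem (gD _ lD) vl.
exact: (prod_below H lD vl).
Qed.

Lemma false_gt_producer C u r D D' : GN C -> ~ ctrue model C ->
  model u = Some r -> produces (below u) u r D D' -> clause_gt gt C D.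
Proof.
move=> iC nC ur H; have [gu gr sr gD] := produces_gwf H.
have gC := instances_gwf inhS wfN iC.
case: (clause_gt_total gtP gC gD) => // [E|gDC].
  by case: nC; rewrite E; apply: produces_true H.
have [l lC lt] := prod_min H iC gDC.
have Cu := clause_gt_below gtP gu gD gC gDC (prod_below H).
have nl : ~ ltrue model l by move=> ml; apply: nC; exists l.
have irr := prod_irred H; have okJ := below_ok (t := u).
have dom_u w : w \in l.2 -> w = u \/ nf (below u) w = nf model w.
  move=> wl; case: (Cu _ _ lC wl) => [|guw]; [by left|right].
  by apply: nf_below => //; apply: gwf_literal_mem (gC _ lC) wl.
(* Such a literal of [C] exceeds [eqn u r] and with it every literal of [D]. *)
suff [w El] : exists w, l = neq u w.
  apply: (mset_ext_dominated lC) => k; rewrite El (prod_eq H) in_mset1D => /orP[/eqP->|kD'].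
    by apply: lit_gt_neq_eqn; apply: prod_gt H.
  have gk : gwf_literal k by apply: gD; rewrite (prod_eq H) mset1Dr.
  have ge : gwf_literal (eqn u r) by apply: gD; rewrite (prod_eq H) mset1D1.
  have gl : gwf_literal (neq u w) by rewrite -El; apply: gC.
  apply: (lit_gt_trans gtP gl ge gk); last exact: produces_max H _ kD'.
  by apply: lit_gt_neq_eqn; apply: prod_gt H.
have [b [s [t [El gs ggt st]]]] := gC _ lC; subst l.
wlog Es : s t lC lt nl dom_u gs ggt st / s = u.
  move=> IH; case: (dom_u s) => [|Es|Es]; first exact: mset21; first exact: (IH s t).
  case: (dom_u t) => [|Et|Et]; first exact: mset22.
    by rewrite litC; apply: IH => //; rewrite litC.
  by case: nl; apply: ltrue_agree lt => v /mset2P[]->.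
(* An equation [eqn u t] can be true with respect to the rules below [u] only if [t] is [u], since
   [u] is irreducible there; but then it is true in the model too. *)
subst s; case: b lC lt nl dom_u => lC lt nl dom_u; last by exists t.
case: nl; apply/ltrueE; move/ltrueE: lt => E.
case: (Cu _ t lC); first exact: mset22; first by move=> ->.
by move=> /(nf_lt okJ gu ggt)/(_ E).
Qed.

(** The entailment is evaluated in the structure of [below u], where the smaller instances are true
    by [prod_min] and [D] is false. The final model would not do: a clause whose rule is adopted is
    true there. *)
Lemma producer_irredundant u r D D' : produces (below u) u r D D' -> ~ GRed_Cl gt GN D.
Proof.
move=> H [_ _ [Ds [DsP ent]]]; apply: (prod_false H).
have [_ _ _ gD] := produces_gwf H.
apply: (entails_ctrue (below_ok (t := u)) inhS _ gD ent) => X /DsP[iX gX].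
  exact: (instances_gwf inhS wfN iX).
exact: prod_min H _ iX gX.
Qed.

Lemma nf_tsubst_nf theta t : ground_subst theta -> wf_term t ->
  nf model (tsubst (fun x => nf model (theta x)) t) = nf model (tsubst theta t).
Proof.
move=> gth; elim/term_mem_ind: t => [x _|f ts IH wt] /=.
  by apply: nf_idem; [apply: model_ok|case: (gth x)].
have gth' : ground_subst (fun x => nf model (theta x)).
  move=> x; have [gx sx] := gth x; have ok := model_ok.
  by rewrite nf_gwf // nf_sort.
rewrite -(nf_App_nf model_ok (gwf_tsubst gth' wt)) -(nf_App_nf model_ok (gwf_tsubst gth wt)).
congr (nf _ (App f _)); rewrite -!map_comp; apply/eq_in_map => t tts /=; apply: IH => //.
by have /= /andP[/allP/(_ _ tts)] := wt.
Qed.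

Context (sat : saturated gt sel N).

(** * The minimal counterexample *)

Section Counterexample.
Context (C : clause S) (iC : GN C) (nC : ~ ctrue model C).
Context (minC : forall D, GN D -> clause_gt gt C D -> ctrue model D).

Let gC : gwf_clause C := instances_gwf inhS wfN iC.

Lemma entailed_below_true E : gwf_clause E -> entailed_below gt GN C E -> ctrue model E.
Proof.
move=> gE [Ds [DsP ent]]; apply: (entails_ctrue model_ok inhS _ gE ent) => X /DsP[iX gX].
  exact: (instances_gwf inhS wfN iX).
exact: minC.
Qed.

Lemma redundant_inference_true Ps E : gwf_clause E ->
  (forall P, P \in Ps -> ~ GRed_Cl gt GN P) -> last bot Ps = C ->
  GRed_I gt gsel GN (GroundInference Ps E) -> ctrue model E.
Proof.
move=> gE nred EC [_ [[P PPs redP]|]] /=; first by case: (nred P).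
by rewrite EC; apply: entailed_below_true.
Qed.

Lemma counterexample_irredundant : ~ GRed_Cl gt GN C.
Proof. by move=> [_ _ ent]; apply: nC; apply: entailed_below_true. Qed.

Lemma rep_normal x : x \in cvars (rep C).1 -> nf model ((rep C).2 x) = (rep C).2 x.
Proof.
move=> xD; apply: contrapT => nx; apply: nC; have [ND gth EC] := repP inhS wfN iC.
move: (rep C).1 (rep C).2 ND gth EC xD nx => D theta ND gth EC xD nx.
pose theta' x := nf model (theta x); have ok := model_ok.
have gth' : ground_subst theta'.
  by move=> y; have [gy sy] := gth y; rewrite /theta' nf_gwf // nf_sort.
have iC' : GN (csubst theta' D) by apply/(instances_setP inhS wfN); exists D, theta'.
have gCC' : clause_gt gt C (csubst theta' D).
  rewrite EC; apply: (csubst_lt gtP (x := x)) => //; first exact: wfN.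
  by move=> y; apply: nf_le => //; case: (gth y).
have [_ /mset_mapP[l lD ->]] := minC iC' gCC'.
have [b [s [t [El ws wt _]]]] := wf_literalP (wfN ND lD).
rewrite El lsubst_lit => /ltrueE; rewrite !nf_tsubst_nf // => H.
exists (lsubst theta l); first by rewrite EC; apply: mset_map_f.
by rewrite El lsubst_lit; apply/ltrueE.
Qed.

Lemma no_sup b c u r t C' : C = lit b (fill c u) t +` C' -> model u = Some r ->
  sup_eligible gt (gsel C) Var C' (lit b (fill c u) t) -> gt (fill c u) t -> False.
Proof.
move=> EC ur el gcut; have ok := model_ok.
have [gu gr gur sur] := model_ok ur; have [D [D' H]] := model_Some ur.
have [_ _ _ gD] := produces_gwf H; have ED := prod_eq H.
have [|gcu ggt st] := @gwf_lit _ b (fill c u) t; first by apply: gC; rewrite EC mset1D1.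
have gcr := gwf_fill_sub sur gr gcu; have nur := nf_model_rule ur.
have red := lift_GSup gtP inhS selP wfN sat iC (prod_inst H) ED EC (prod_elig H) el gur gcut
  (false_gt_producer iC nC ur H).
have {}red : GRed_I gt gsel GN
    (GroundInference [:: D; C] (C' `+` D' `+` [mset lit b (fill c r) t])).
  (* Inside the normal image of a variable, [u] would be normal as a subterm of a normal term, yet
     it is the left-hand side of a rule. *)
  apply: red => x c1 xC Ex; have [_ gth _] := repP inhS wfN iC; have [gx _] := gth x.
  have := rep_normal xC; rewrite Ex => /(nf_id_fill ok); rewrite -Ex => /(_ gx).
  exact: nf_lt gur nur.
have : ctrue model (C' `+` D' `+` [mset lit b (fill c r) t]).
  apply: redundant_inference_true red => //.
    move=> l; rewrite !in_msetD => /orP[/orP[lC'|lD']|/mset1P->].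
    - by apply: gC; rewrite EC mset1Dr.
    - by apply: gD; rewrite ED mset1Dr.
    - by exists b, (fill c r), t; split=> //; rewrite -(tsort_fill c sur).
  move=> P; rewrite !inE => /orP[]/eqP->; first exact: producer_irredundant H.
  exact: counterexample_irredundant.
(* [C'] is false with [C], [D'] is false by [produces_rest], and rewriting [u] to [r] preserves the
   truth value of the literal. *)
case/ctrueD=> [/ctrueD[tC'|]|/ctrue1/ltrueE]; last rewrite -(nf_fill ok gcu gr sur nur) => tl.
- by apply: nC; rewrite EC; apply/ctrueD; right.
- exact: produces_rest H.
- by apply: nC; rewrite EC; apply/ctrueD; left; apply/ctrue1/ltrueE.
Qed.

Lemma no_eqfact s t w C' : C = eqn s t +` (eqn s w +` C') ->
  eligible gt (gsel C) Var (eqn s w +` C') (eqn s t) -> gt s t -> gt s w ->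
  nf model t = nf model w -> False.
Proof.
move=> EC el gst gsw ntw.
have red := lift_GEqFact gtP inhS selP wfN sat iC EC el gst gsw.
have [|gs ggt sst] := @gwf_lit _ true s t; first by apply: gC; rewrite EC mset1D1.
have [|_ gw ssw] := @gwf_lit _ true s w; first by apply: gC; rewrite EC mset1Dr // mset1D1.
have : ctrue model (C' `+` [mset neq t w; eqn s t]).
  apply: redundant_inference_true red => //.
    move=> l; rewrite !in_msetD => /orP[lC'|/orP[]/mset1P->].
    - by apply: gC; rewrite EC !mset1Dr.
    - by exists false, t, w; split=> //; rewrite -sst.
    - by exists true, s, t.
  by move=> P; rewrite inE => /eqP->; apply: counterexample_irredundant.
case/ctrueD=> [tC'|/ctrueD[/ctrue1/ltrueE/(_ ntw)[]|tst]].
  by apply: nC; rewrite EC; apply/ctrueD; right; apply/ctrueD; right.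
by apply: nC; rewrite EC; apply/ctrueD; left.
Qed.

(** With [w] equal to [t] this also covers a maximal equation that occurs twice. *)
Lemma no_duplicate s t w C' : C = eqn s t +` C' -> eqn s w \in C' ->
  eligible gt (gsel C) Var C' (eqn s t) -> gt s t -> gt s w -> nf model t = nf model w -> False.
Proof.
move=> EC swC' el; have Esw := msetB1K swC'; rewrite -Esw in el.
exact: no_eqfact (etrans EC (congr1 (msetD [mset eqn s t]) (esym Esw))) el.
Qed.

Lemma no_eqres s C' : C = neq s s +` C' -> ~ eligible gt (gsel C) Var C' (neq s s).
Proof.
move=> EC el; have red := lift_GEqRes gtP inhS selP wfN sat iC EC el.
have tC' : ctrue model C'.
  apply: redundant_inference_true red => //; first by move=> l lC'; apply: gC; rewrite EC mset1Dr.
  by move=> P; rewrite inE => /eqP->; apply: counterexample_irredundant.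
by apply: nC; rewrite EC; apply/ctrueD; right.
Qed.

(** As [s] has no rule, [C] must fail a condition of [produces], and only [prod_rest] can fail: some
    literal of [C'] becomes true with the rule from [s] to [t]. It can only be some [eqn s w] with
    [w] and [t] of equal normal form, so factoring applies. *)
Lemma no_irreducible s t C' : C = eqn s t +` C' -> gsel C = mset0 ->
  (forall k, k \in C' -> lit_gt gt (eqn s t) k) -> gt s t -> nf model s = s -> False.
Proof.
move=> EC sel0 maxl gst irr; have ok := model_ok.
have gl : gwf_literal (eqn s t) by apply: gC; rewrite EC mset1D1.
have [gs ggt sst] := gwf_lit gl.
have sN : model s = None.
  case E : (model s) => [r|//]; have [_ gr gsr _] := model_ok E.
  by case: (nf_lt ok gs gr gsr (nf_model_rule E) irr).
have gk k : k \in C' -> gwf_literal k by move=> kC'; apply: gC; rewrite EC mset1Dr.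
have nle k : k \in C' -> ~ lit_le gt (eqn s t) k.
  move=> kC' [E|gkl]; first by apply: (wf_irr (lit_gt_wf gtP) gl); rewrite {2}E; apply: maxl.
  exact: (wf_asym (lit_gt_wf gtP) gl (gk _ kC') (maxl _ kC') gkl).
have Cs : clause_below C s.
  move=> k w kC wk; have gw := gwf_literal_mem (gC kC) wk.
  case: (gwf_total gtP gw gs) => [->|gws|]; [by left| |by right].
  move: kC; rewrite EC in_mset1D => /orP[/eqP Ek|kC'].
    by move: wk; rewrite Ek => /mset2P[]->; [left|right].
  case: (nle _ kC'); right; apply: (lit_gt_dominated wk) => v /mset2P[]-> //.
  exact: gwf_gt_trans gws gst.
have agr v l : l \in C -> v \in l.2 -> nf model v = nf (below s) v.
  move=> lC vl; rewrite nf_below_None //; first exact: gwf_literal_mem (gC lC) vl.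
  exact: Cs vl.
have okU : rules_ok (add_rule (below s) s t) by apply: add_rule_ok => //; apply: below_ok.
have irrJ : nf (below s) s = s by rewrite nf_below_None //; left.
have [k kC' tk] : ctrue (add_rule (below s) s t) C'.
  apply: contrapT => nC'; apply: (@model_None s t C C' sN); split=> //.
  - by move=> tC; apply: nC; apply: ctrue_agree tC => l v lC vl; apply/esym; apply: agr vl.
  - move=> X iX gX; have tX := minC iX gX; apply: ctrue_agree tX => l v lX vl.
    have gXX := instances_gwf inhS wfN iX.
    rewrite nf_below_None //; first exact: gwf_literal_mem (gXX _ lX) vl.
    exact: (clause_gt_below gtP gs gC gXX gX Cs lX vl).
  - by right; split=> // l' l'C'; rewrite !lsubst_Var; apply: nle.
have nk : ~ ltrue model k by move=> mk; apply: nC; rewrite EC; apply/ctrueD; right; exists k.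
have kC : k \in C by rewrite EC mset1Dr.
have [b [v [w [Ek gv gw svw]]]] := gk _ kC'; subst k.
(* A literal with both sides below [s] has the same truth value with the added rule as in the model,
   so one side is [s]. *)
wlog Ev : v w kC kC' tk nk gv gw svw / v = s.
  move=> IH; case: (Cs _ v kC); [exact: mset21|exact: (IH v w)|move=> gsv].
  case: (Cs _ w kC); [exact: mset22| |move=> gsw].
    by move: kC kC' tk nk; rewrite litC => kC kC' tk nk; apply: (IH w v).
  case: nk; apply: ltrue_agree tk => u /mset2P[]->; exact: nf_add_rule_lt.
subst v; move/ltrueE: tk => tk.
case: (Cs _ w kC); [exact: mset22| |move=> gsw].
  move=> E; subst w; apply: nk; apply/ltrueE; by case: b tk {kC kC'}.
(* A disequation between the irreducible [s] and a smaller [w] is true in the model, contrary to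
   [nk]. *)
case: b kC kC' tk nk => kC kC' tk nk; last first.
  by apply: nk; apply/ltrueE => E; apply: nf_lt gsw E irr.
rewrite nf_add_rule_top // nf_add_rule_lt // in tk.
have swC' : eqn s w \in C' := kC'.
apply: (no_duplicate EC swC' _ gst gsw tk).
by right; split=> // l' l'C'; rewrite !lsubst_Var => g; apply: (nle _ l'C'); right.
Qed.

Lemma counterexample_bot : C = bot.
Proof.
apply: contrapT => C0; have ok := model_ok.
have [l [C' [EC el]]] : exists l C', C = l +` C' /\
    (l \in gsel C \/ gsel C = mset0 /\ forall k, k \in C' -> k = l \/ lit_gt gt l k).
  have [s0|/eqP/mset_neq0_ex[l ls]] := eqVneq (gsel C) mset0; last first.
    have [lC _] := gsel_neg selP wfN gC ls.
    by exists l, (C `\ l); rewrite msetB1K //; split=> //; left.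
  have [l lC lmax] : exists2 m, m \in C & forall x, x \in C -> x = m \/ lit_gt gt m x.
    apply: mset_max => // [x y z /gC ? /gC ? /gC ?|x y /gC ? /gC ?].
      exact: lit_gt_trans.
    exact: lit_gt_total.
  exists l, (C `\ l); rewrite msetB1K //; split=> //; right; split=> // k kC'.
  by apply: lmax; rewrite -(msetB1K lC) mset1Dr.
have lC : l \in C by rewrite EC mset1D1.
have gl := gC lC.
have elig : eligible gt (gsel C) Var C' l.
  case: el => [|[s0 lmax]]; [by left|right; split=> // k kC'; rewrite !lsubst_Var].
  have gk : gwf_literal k by apply: gC; rewrite EC mset1Dr.
  case: (lmax _ kC') => [->|glk]; first exact: (wf_irr (lit_gt_wf gtP) gl).
  exact: (wf_asym (lit_gt_wf gtP) gl gk glk).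
have nl : ~ ltrue model l by move=> tl; apply: nC; exists l.
have [b [s [t [El gs ggt sst]]]] := gl; subst l.
wlog gst : s t EC el lC gl elig nl gs ggt sst / s = t \/ gt s t.
  move=> IH; case: (gwf_total gtP gs ggt) => [E|g|g]; [apply: (IH s t)|apply: (IH s t)|] => //.
  - by left.
  - by right.
  by move: EC el lC gl elig nl; rewrite litC => *; apply: (IH t s) => //; right.
case: gst => [E|gst].
  subst t; case: b EC el lC gl elig nl => EC el lC gl elig nl.
    by apply: nl; apply/ltrueE.
  exact: no_eqres EC elig.
have reducible : sup_eligible gt (gsel C) Var C' (lit b s t) -> nf model s <> s -> False.
  move=> el' /(nf_reducible ok gs)[c [u [r [Es ur]]]]; subst s.
  exact: (no_sup EC ur el' gst).
case: b EC el lC gl elig nl reducible => EC el lC gl elig nl reducible; last first.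
  (* A false disequation has sides of equal normal form, so its larger side is reducible. *)
  apply: reducible => //; apply: (nf_lt ok gs ggt gst).
  by apply: contrapT => ne; apply: nl; apply/ltrueE.
case: el => [ls|[s0 lmax]]; first by move: (gsel_pos (l := eqn s t) iC isT); rewrite ls.
(* A second copy of the maximal equation defeats the strict maximality that superposition demands;
   factoring the two copies takes over. *)
have [lC'|lC'] := boolP (eqn s t \in C').
  exact: (no_duplicate EC lC' elig gst gst erefl).
have smax k : k \in C' -> lit_gt gt (eqn s t) k.
  by move=> kC'; case: (lmax _ kC') => // E; case/negP: lC'; move: kC'; rewrite E.
case: (pselect (nf model s = s)) => [|ns]; first exact: no_irreducible EC s0 smax gst.
apply: reducible ns; right; split=> // k kC'; rewrite !lsubst_Var => -[E|gkl].
  by case/negP: lC'; move: kC'; rewrite -E.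
have gk : gwf_literal k by apply: gC; rewrite EC mset1Dr.
exact: (wf_asym (lit_gt_wf gtP) gl gk (smax _ kC') gkl).
Qed.

End Counterexample.

Lemma model_true : ~ N bot -> forall C, GN C -> ctrue model C.
Proof.
move=> Nbot C; elim/(well_founded_ind (clause_gt_wf gtP)): C => C IH iC.
apply: contrapT => nC; apply: Nbot.
have C0 : C = bot.
  apply: counterexample_bot => // D iD gCD; apply: IH => //.
  by split=> //; apply: (instances_gwf inhS wfN).
(* Only the empty clause has an empty instance. *)
have /(instances_setP inhS wfN)[D [theta [ND _]]] := iC.
by rewrite C0 => /esym/mset_map_eq0 D0; rewrite -[bot]D0.
Qed.

Lemma saturated_complete : entails N bot -> N bot.
Proof.
move=> ent; apply: contrapT => Nbot.
have tG := model_true Nbot.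
have Mbot : models (nf_structure (gtP := gtP) model_ok inhS) bot.
  apply: ent => D ND; apply: models_instances; first exact: wfN.
  by move=> theta gth; apply: tG; apply/(instances_setP inhS wfN); exists D, theta.
have [|theta _ [l]] := models_valuation _ Mbot; first by move=> l; rewrite in_mset0.
by rewrite /csubst mset_map0 in_mset0.
Qed.

End Completeness.

Theorem theorem1 (S : signature) (inhS : sorts_inhabited S)
    (gt : term S -> term S -> Prop) (gtP : simplification_order gt)
    (sel : clause S -> clause S) (selP : selection_function sel)
    (N : clause S -> Prop) (wfN : forall C, N C -> wf_clause C) :
  saturated gt sel N -> (entails N bot <-> N bot).
Proof.
move=> sat; split; first exact: (saturated_complete gtP inhS selP wfN sat).
by move=> Nbot M; apply.
Qed.
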